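(* Let $\mathcal{L}$ be DLR or HAR. For each inductive $\mathcal{L}$-inequality, there exists a safe and successful execution of $\mathsf{ALBA}^r$ on it.
   Context: Language. Fix $\eta_f,\eta_g\in\{1,\partial\}$ and order types $\epsilon_k\in\{1,\partial\}^m$, $\epsilon_l\in\{1,\partial\}^n$, recording in which coordinates the connectives $f$ (unary), $g$ (unary), $k$ ($m$-ary), $l$ ($n$-ary) are monotone (value $1$) or antitone (value $\partial$). DLR-terms are built from propositional variables, $\top,\bot,\wedge,\vee,f,g,k,l$; HAR-terms additionally use $\to$ (antitone in the first, monotone in the second coordinate). (Intended algebras: bounded distributive lattices, resp. Heyting algebras, with $f,k$ preserving finite nonempty joins and $g,l$ preserving finite nonempty meets in each coordinate, from the lattice or its order dual according to the order types.) Signed generation trees. $\pm s$: sign the root $\pm$, keep the sign at children in monotone coordinates and switch it at children in antitone coordinates. For an order type $\epsilon$ on $p_1,\dots,p_n$, an $\epsilon$-critical leaf is $+p_i$ with $\epsilon_i=1$ or $-p_i$ with $\epsilon_i=\partial$; an $\epsilon$-critical branch ends in such a leaf. A signed (sub)tree agrees with $\epsilon$ if all its variable leaves are $\epsilon$-critical; $\epsilon^\partial$ is the order type obtained by swapping $1$ and $\partial$. Classification of nodes. Skeleton (SAC) nodes: $+\vee,+\wedge,+f,+k,-\wedge,-\vee,-g,-l$, and for HAR also $-\to$. PIA nodes: SMP nodes $+\wedge,+g,-\vee,-f$, and SRR nodes $+\vee,-\wedge$, and for HAR also $+\to$. A branch is good if it is the concatenation of paths $P_1,P_2$ (one possibly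 of length $0$) with $P_1$ a path from the leaf consisting (apart from variable nodes) only of PIA nodes and $P_2$ consisting (apart from variable nodes) only of Skeleton nodes. Inductive inequalities. Let $\epsilon$ be an order type and $\Omega$ an irreflexive transitive relation on $p_1,\dots,p_n$. $*s$ is $(\Omega,\epsilon)$-inductive if every $\epsilon$-critical branch, with leaf labelled $p_i$ say, is good, and moreover, for every binary SRR node $\alpha\circ\beta$ in $P_1$ (with the branch running through $\beta$; up to commutativity for $\vee,\wedge$): the signed subtree of $\alpha$ in $*s$ agrees with $\epsilon^\partial$ (in particular, critical branches pass through $+\to$ only via its second coordinate), and $p_j<_\Omega p_i$ for every $p_j$ occurring in $\alpha$. $s\le t$ is $(\Omega,\epsilon)$-inductive if $+s$ and $-t$ both are, and inductive if it is so for some $\Omega,\epsilon$. Expanded language $\mathcal{L}^+$. It adds nominals $\mathbf{i},\mathbf{j},\dots$, conominals $\mathbf{m},\mathbf{n},\dots$, connectives $\to$ and $-$ (where $-$ is monotone in the first and antitone in the second coordinate), the unary monotone $\blacksquare_f$ if $\eta_f=1$ or antitone $\blacktriangleleft_f$ if $\eta_f=\partial$, and the unary monotone $\text{◆}_g$ if $\eta_g=1$ or antitone $\blacktriangleright_g$ if $\eta_g=\partial$. Pure means without propositional variables. The algorithm $\mathsf{ALBA}^r$ on input $\varphi\le\psi$. Stage 1 (preprocessing). Exhaustively apply to the signed generation trees $+\varphi$, $-\psi$ the following steps. (1) (a) Push down, towards variables, occurrences of $+\wedge$, $+f$ (if $\eta_f=1$), $-g$ (if $\eta_g=\partial$), $+k$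 (for $\epsilon_k(i)=1$), $-l$ (for $\epsilon_l(i)=\partial$), by distributing them over nodes labelled with $+\vee$ (in the $i$-th coordinate for $k,l$) which are SAC nodes; (b) push down, towards variables, occurrences of $-\vee$, $-g$ (if $\eta_g=1$), $+f$ (if $\eta_f=\partial$), $+k$ (for $\epsilon_k(i)=\partial$), $-l$ (for $\epsilon_l(i)=1$), by distributing them over nodes labelled with $-\wedge$ (in the $i$-th coordinate for $k,l$) which are SAC nodes. (2) Splitting: replace $\alpha\le\beta\wedge\gamma$ by $\alpha\le\beta,\ \alpha\le\gamma$; replace $\alpha\vee\beta\le\gamma$ by $\alpha\le\gamma,\ \beta\le\gamma$. (3) Variable elimination: for $\beta(p)$ positive and $\alpha(p)$ negative in $p$, replace $\alpha(p)\le\beta(p)$ by $\alpha(\bot)\le\beta(\bot)$, and $\beta(p)\le\alpha(p)$ by $\beta(\top)\le\alpha(\top)$. The result is a finite set $\mathsf{Preprocess}(\varphi\le\psi)$. To each member $\varphi_i\le\psi_i$ apply once the first approximation rule, producing the initial system $\{\mathbf{i}_0\le\varphi_i,\ \psi_i\le\mathbf{m}_0\}$. Stage 2 (reduction). Transform systems with the following rules (all nominals and conominals introduced must be fresh; each alternative produced yields a separate system). Splitting: replace $\alpha\le\beta\wedge\gamma$ by $\alpha\le\beta,\ \alpha\le\gamma$; replace $\alpha\vee\beta\le\gamma$ by $\alpha\le\gamma,\ \beta\le\gamma$. Residuation: from $\phi\wedge\psi\le\chi$ to $\psi\le\phi\to\chi$ (for HAR also in the converse direction); from $\phi\le\psi\vee\chi$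 to $\phi-\chi\le\psi$. Adjunction: $f(\phi)\le\psi$ is replaced by $f(\bot)\le\psi,\ \phi\le\blacksquare_f\psi$ if $\eta_f=1$, and by $f(\top)\le\psi,\ \blacktriangleleft_f\psi\le\phi$ if $\eta_f=\partial$; $\phi\le g(\psi)$ is replaced by $\phi\le g(\top),\ \text{◆}_g\phi\le\psi$ if $\eta_g=1$, and by $\phi\le g(\bot),\ \psi\le\blacktriangleright_g\phi$ if $\eta_g=\partial$. The first inequality of each pair is called the side condition. Approximation: $\mathbf{i}\le f(\phi)$ is replaced by the alternatives $[\mathbf{i}\le f(\bot)]$ or $[\mathbf{j}\le\phi,\ \mathbf{i}\le f(\mathbf{j})]$ if $\eta_f=1$, and $[\mathbf{i}\le f(\top)]$ or $[\phi\le\mathbf{m},\ \mathbf{i}\le f(\mathbf{m})]$ if $\eta_f=\partial$; $g(\psi)\le\mathbf{m}$ is replaced by $[g(\top)\le\mathbf{m}]$ or $[\psi\le\mathbf{n},\ g(\mathbf{n})\le\mathbf{m}]$ if $\eta_g=1$, and $[g(\bot)\le\mathbf{m}]$ or $[\mathbf{i}\le\psi,\ g(\mathbf{i})\le\mathbf{m}]$ if $\eta_g=\partial$. Writing $\epsilon^+,\epsilon^-$ for the sets of coordinates of order type $1$, $\partial$: $\mathbf{i}\le k(\overline\phi_{\epsilon_k^+},\overline\psi_{\epsilon_k^-})$ is replaced by the alternatives, one for each $P\subseteq\epsilon_k^+$, $N\subseteq\epsilon_k^-$, consisting of $\mathbf{i}\le k(\overline{\mathbf{j}}_P,\overline\bot_{\epsilon_k^+\setminus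 P},\overline{\mathbf{m}}_N,\overline\top_{\epsilon_k^-\setminus N})$, $\mathbf{j}_e\le\phi_e$ ($e\in P$), $\psi_e\le\mathbf{m}_e$ ($e\in N$); and $l(\overline\phi_{\epsilon_l^+},\overline\psi_{\epsilon_l^-})\le\mathbf{m}$ by the alternatives, one for each $P\subseteq\epsilon_l^+$, $N\subseteq\epsilon_l^-$, consisting of $l(\overline{\mathbf{n}}_P,\overline\top_{\epsilon_l^+\setminus P},\overline{\mathbf{i}}_N,\overline\bot_{\epsilon_l^-\setminus N})\le\mathbf{m}$, $\phi_e\le\mathbf{n}_e$ ($e\in P$), $\mathbf{i}_e\le\psi_e$ ($e\in N$). For HAR only: $\phi\to\chi\le\mathbf{m}$ is replaced by $\mathbf{j}\le\phi,\ \chi\le\mathbf{n},\ \mathbf{j}\to\mathbf{n}\le\mathbf{m}$. Ackermann rules (applied to a whole system): the right rule replaces $\{\alpha_i\le p\}_{i=1}^n\cup\{\beta_j(p)\le\gamma_j(p)\}_{j=1}^{r}$ by $\{\beta_j(\bigvee_i\alpha_i)\le\gamma_j(\bigvee_i\alpha_i)\}_j$, where $p$ does not occur in the $\alpha_i$, the $\beta_j$ are positive and the $\gamma_j$ negative in $p$; the left rule replaces $\{p\le\alpha_i\}_{i=1}^n\cup\{\beta_j(p)\le\gamma_j(p)\}_{j=1}^r$ by $\{\beta_j(\bigwedge_i\alpha_i)\le\gamma_j(\bigwedge_i\alpha_i)\}_j$, where $p$ does not occur in the $\alpha_i$, the $\beta_j$ are negative and the $\gamma_j$ positive in $p$ (empty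 joins and meets are $\bot$, $\top$; inequalities without $p$ are unaffected). Stage 3 (output). The run succeeds if all propositional variables have been eliminated from all systems; the output is the set of pure quasi-inequalities $\&[S]\Rightarrow\mathbf{i}_0\le\mathbf{m}_0$ for all final systems $S$. Safe execution. An execution is safe if no side condition introduced by an application of an adjunction rule for $f$ or $g$ is further modified, except for receiving Ackermann substitutions.
   Formalization: For HAR, Stage 1 also distributes −→ over +∨ (first coordinate) and −∧ (second), as for −l of order type (∂,1); with the listed nodes only, the claim fails for the inductive inequality ⊤ ≤ (p∨gp)→f(gp) with f, g monotone. *)

(* Defs.v *)
From Stdlib Require Import Relations.
From mathcomp Require Import all_boot.

Set Implicit Arguments.
Unset Strict Implicit.
Unset Printing Implicit Defensive.

Variant logic := DLR | HAR.

Definition is_har (L : logic) : bool := if L is HAR then true else false.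

(* An order type takes the value [true] for 1 (monotone) and [false] for the
   dual order (antitone). *)
Record signature := Signature {
  eta_f : bool;
  eta_g : bool;
  arity_k : nat;
  arity_l : nat;
  eps_k : 'I_arity_k -> bool;
  eps_l : 'I_arity_l -> bool
}.

(* Terms of the expanded language; the terms of DLR and HAR are singled out by
   [lang_term].  [Adj_f] is the black box (eta_f = 1) or the left black triangle
   (eta_f = dual) of [Op_f]; [Adj_g] is the black diamond (eta_g = 1) or the
   right black triangle (eta_g = dual) of [Op_g].  [Diff a b] is a - b. *)
Inductive term (sg : signature) : Type :=
| Var of nat
| Nom of nat
| Conom of nat
| Top
| Bot
| And of term sg & term sg
| Or of term sg & term sg
| Op_f of term sg
| Op_g of term sg
| Op_k of ('I_(arity_k sg) -> term sg)
| Op_l of ('I_(arity_l sg) -> term sg)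
| Imp of term sg & term sg
| Diff of term sg & term sg
| Adj_f of term sg
| Adj_g of term sg.

Arguments Var {sg} _.
Arguments Nom {sg} _.
Arguments Conom {sg} _.
Arguments Top {sg}.
Arguments Bot {sg}.

(* The pair (a, b) stands for the inequality a <= b. *)
Definition ineq (sg : signature) : Type := (term sg * term sg)%type.

Section Syntax.

Variable sg : signature.
Implicit Types (a b c t u : term sg) (p : nat).

Fixpoint lang_term (L : logic) t : bool :=
  match t with
  | Var _ | Top | Bot => true
  | And a b | Or a b => lang_term L a && lang_term L b
  | Op_f a | Op_g a => lang_term L a
  | Op_k ts => [forall i, lang_term L (ts i)]
  | Op_l ts => [forall i, lang_term L (ts i)]
  | Imp a b => [&& is_har L, lang_term L a & lang_term L b]
  | Nom _ | Conom _ | Diff _ _ | Adj_f _ | Adj_g _ => false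
  end.

Fixpoint subst p u t : term sg :=
  match t with
  | Var q => if q == p then u else t
  | Nom _ | Conom _ | Top | Bot => t
  | And a b => And (subst p u a) (subst p u b)
  | Or a b => Or (subst p u a) (subst p u b)
  | Op_f a => Op_f (subst p u a)
  | Op_g a => Op_g (subst p u a)
  | Op_k ts => Op_k (fun i => subst p u (ts i))
  | Op_l ts => Op_l (fun i => subst p u (ts i))
  | Imp a b => Imp (subst p u a) (subst p u b)
  | Diff a b => Diff (subst p u a) (subst p u b)
  | Adj_f a => Adj_f (subst p u a)
  | Adj_g a => Adj_g (subst p u a)
  end.

(* Indices of the nominals and conominals of a term: a name is called fresh
   below when neither the nominal nor the conominal of that index occurs. *)
Fixpoint names t : seq nat :=
  match t with
  | Nom x | Conom x => [:: x]
  | Var _ | Top | Bot => [::]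
  | And a b | Or a b | Imp a b | Diff a b => names a ++ names b
  | Op_f a | Op_g a | Adj_f a | Adj_g a => names a
  | Op_k ts => flatten [seq names (ts i) | i <- enum 'I_(arity_k sg)]
  | Op_l ts => flatten [seq names (ts i) | i <- enum 'I_(arity_l sg)]
  end.

Definition is_var p t : bool := if t is Var q then q == p else false.

Definition update n (ts : 'I_n -> term sg) (i : 'I_n) u : 'I_n -> term sg :=
  fun j => if j == i then u else ts j.

Fixpoint bigjoin (ts : seq (term sg)) : term sg :=
  match ts with
  | [::] => Bot
  | [:: a] => a
  | a :: ts' => Or a (bigjoin ts')
  end.

Fixpoint bigmeet (ts : seq (term sg)) : term sg :=
  match ts with
  | [::] => Top
  | [:: a] => a
  | a :: ts' => And a (bigmeet ts')
  end.

End Syntax.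

(** Signed generation trees.  The sign + is [true] and - is [false]. *)

Definition child_sign (o s : bool) : bool := if o then s else ~~ s.

Section SignedTrees.

Variable sg : signature.
Implicit Types (a b c t u : term sg) (p : nat) (s : bool).

(* The immediate subterms together with the order types of their coordinates. *)
Definition children t : seq (bool * term sg) :=
  match t with
  | Var _ | Nom _ | Conom _ | Top | Bot => [::]
  | And a b | Or a b => [:: (true, a); (true, b)]
  | Op_f a => [:: (eta_f sg, a)]
  | Op_g a => [:: (eta_g sg, a)]
  | Op_k ts => [seq (eps_k i, ts i) | i <- enum 'I_(arity_k sg)]
  | Op_l ts => [seq (eps_l i, ts i) | i <- enum 'I_(arity_l sg)]
  | Imp a b => [:: (false, a); (true, b)]
  | Diff a b => [:: (true, a); (false, b)]
  | Adj_f a => [:: (eta_f sg, a)]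
  | Adj_g a => [:: (eta_g sg, a)]
  end.

(* A node of a branch: its sign, the subterm rooted at it, and the coordinate
   through which the branch continues. *)
Definition node : Type := (bool * term sg * nat)%type.

(* [branch s t ns s' p]: the tree of t with root sign s has a branch ending in
   a variable leaf p of sign s'; ns lists its other nodes, root first. *)
Inductive branch : bool -> term sg -> seq node -> bool -> nat -> Prop :=
| branch_leaf s p : branch s (Var p) [::] s p
| branch_node s t (c : nat) o u ns s' p :
    onth (children t) c = Some (o, u) ->
    branch (child_sign o s) u ns s' p ->
    branch s t ((s, t, c) :: ns) s' p.

(* The variable leaves of the tree of t with root sign s, with their signs. *)
Fixpoint leaves s t : seq (bool * nat) :=
  match t with
  | Var p => [:: (s, p)]
  | Nom _ | Conom _ | Top | Bot => [::]
  | And a b | Or a b => leaves s a ++ leaves s b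
  | Op_f a => leaves (child_sign (eta_f sg) s) a
  | Op_g a => leaves (child_sign (eta_g sg) s) a
  | Op_k ts => flatten [seq leaves (child_sign (eps_k i) s) (ts i)
                          | i <- enum 'I_(arity_k sg)]
  | Op_l ts => flatten [seq leaves (child_sign (eps_l i) s) (ts i)
                          | i <- enum 'I_(arity_l sg)]
  | Imp a b => leaves (~~ s) a ++ leaves s b
  | Diff a b => leaves s a ++ leaves (~~ s) b
  | Adj_f a => leaves (child_sign (eta_f sg) s) a
  | Adj_g a => leaves (child_sign (eta_g sg) s) a
  end.

Definition vars t : seq nat := unzip2 (leaves true t).

Definition positive p t : bool :=
  all (fun l : bool * nat => (l.2 == p) ==> l.1) (leaves true t).

Definition negative p t : bool :=
  all (fun l : bool * nat => (l.2 == p) ==> ~~ l.1) (leaves true t).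

Definition skeleton (L : logic) s t : bool :=
  match t with
  | And _ _ | Or _ _ => true
  | Op_f _ | Op_k _ => s
  | Op_g _ | Op_l _ => ~~ s
  | Imp _ _ => is_har L && ~~ s
  | _ => false
  end.

Definition smp s t : bool :=
  match t with
  | And _ _ | Op_g _ => s
  | Or _ _ | Op_f _ => ~~ s
  | _ => false
  end.

Definition srr (L : logic) s t : bool :=
  match t with
  | Or _ _ => s
  | And _ _ => ~~ s
  | Imp _ _ => is_har L && s
  | _ => false
  end.

Definition pia (L : logic) s t : bool := smp s t || srr L s t.

Definition critical (eps : nat -> bool) s p : bool := s == eps p.

Definition dual (eps : nat -> bool) : nat -> bool := fun p => ~~ eps p.

Definition agrees (eps : nat -> bool) s t : bool :=
  all (fun l : bool * nat => critical eps l.1 l.2) (leaves s t).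

Definition side_subtree (Om : rel nat) (eps : nat -> bool) p s t : bool :=
  agrees (dual eps) s t && all (fun q => Om q p) (vars t).

(* The condition on an SRR node of a branch with leaf p.  The last case
   excludes the branches through the first coordinate of an implication. *)
Definition srr_condition (Om : rel nat) (eps : nat -> bool) p (nd : node) :
    bool :=
  let: (s, t, c) := nd in
  match t, c with
  | Or a b, 0 | And a b, 0 => side_subtree Om eps p s b
  | Or a b, 1 | And a b, 1 => side_subtree Om eps p s a
  | Imp a b, 1 => side_subtree Om eps p (~~ s) a
  | _, _ => false
  end.

(* Branches are listed from the root, hence P2 comes before P1. *)
Definition inductive_tree (L : logic) (Om : rel nat) (eps : nat -> bool) s t :
    Prop :=
  forall ns s' p, branch s t ns s' p -> critical eps s' p ->
  exists P2 P1 : seq node,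
    [/\ ns = P2 ++ P1,
        all (fun nd : node => skeleton L nd.1.1 nd.1.2) P2,
        all (fun nd : node => pia L nd.1.1 nd.1.2) P1 &
        all (fun nd : node =>
               srr L nd.1.1 nd.1.2 ==> srr_condition Om eps p nd) P1].

Definition inductive_ineq (L : logic) (phi psi : term sg) : Prop :=
  exists (Om : rel nat) (eps : nat -> bool),
    [/\ irreflexive Om, transitive Om,
        inductive_tree L Om eps true phi &
        inductive_tree L Om eps false psi].

End SignedTrees.

Section Preprocessing.

Variables (sg : signature) (L : logic).
Implicit Types (a b c t u : term sg) (p : nat) (s : bool).

(* [distr_root s t t']: t' is obtained from t, rooted at sign s, by distributing
   the root over a child labelled +\/ or -/\.  In HAR the node - -> distributes
   like a node -l with order type (dual, 1); otherwise the inductive inequality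
   T <= ((p \/ g p) -> f g p) with monotone f, g could not be solved for p. *)
Inductive distr_root : bool -> term sg -> term sg -> Prop :=
| distr_and_l a b c :
    distr_root true (And (Or a b) c) (Or (And a c) (And b c))
| distr_and_r a b c :
    distr_root true (And a (Or b c)) (Or (And a b) (And a c))
| distr_or_l a b c :
    distr_root false (Or (And a b) c) (And (Or a c) (Or b c))
| distr_or_r a b c :
    distr_root false (Or a (And b c)) (And (Or a b) (Or a c))
| distr_f_mon a b : eta_f sg ->
    distr_root true (Op_f (Or a b)) (Or (Op_f a) (Op_f b))
| distr_f_ant a b : ~~ eta_f sg ->
    distr_root true (Op_f (And a b)) (Or (Op_f a) (Op_f b))
| distr_g_mon a b : eta_g sg ->
    distr_root false (Op_g (And a b)) (And (Op_g a) (Op_g b))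
| distr_g_ant a b : ~~ eta_g sg ->
    distr_root false (Op_g (Or a b)) (And (Op_g a) (Op_g b))
| distr_k_mon (ts : 'I_(arity_k sg) -> term sg) i a b :
    eps_k i -> ts i = Or a b ->
    distr_root true (Op_k ts) (Or (Op_k (update ts i a)) (Op_k (update ts i b)))
| distr_k_ant (ts : 'I_(arity_k sg) -> term sg) i a b :
    ~~ eps_k i -> ts i = And a b ->
    distr_root true (Op_k ts) (Or (Op_k (update ts i a)) (Op_k (update ts i b)))
| distr_l_mon (ts : 'I_(arity_l sg) -> term sg) i a b :
    eps_l i -> ts i = And a b ->
    distr_root false (Op_l ts)
      (And (Op_l (update ts i a)) (Op_l (update ts i b)))
| distr_l_ant (ts : 'I_(arity_l sg) -> term sg) i a b :
    ~~ eps_l i -> ts i = Or a b ->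
    distr_root false (Op_l ts)
      (And (Op_l (update ts i a)) (Op_l (update ts i b)))
| distr_imp_l a b c : is_har L ->
    distr_root false (Imp (Or a b) c) (And (Imp a c) (Imp b c))
| distr_imp_r a b c : is_har L ->
    distr_root false (Imp a (And b c)) (And (Imp a b) (Imp a c)).

(* One distribution step inside the signed tree of t.  Being both Skeleton and
   PIA labels, +\/ and -/\ count as SAC nodes when they can lie on the Skeleton
   part of a branch, i.e. when all their ancestors are Skeleton nodes; this is
   why only Skeleton nodes are crossed. *)
Inductive distr : bool -> term sg -> term sg -> Prop :=
| distr_here s t t' : distr_root s t t' -> distr s t t'
| distr_in_and_l s a a' b :
    skeleton L s (And a b) -> distr s a a' -> distr s (And a b) (And a' b)
| distr_in_and_r s a b b' :
    skeleton L s (And a b) -> distr s b b' -> distr s (And a b) (And a b')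
| distr_in_or_l s a a' b :
    skeleton L s (Or a b) -> distr s a a' -> distr s (Or a b) (Or a' b)
| distr_in_or_r s a b b' :
    skeleton L s (Or a b) -> distr s b b' -> distr s (Or a b) (Or a b')
| distr_in_f s a a' :
    skeleton L s (Op_f a) -> distr (child_sign (eta_f sg) s) a a' ->
    distr s (Op_f a) (Op_f a')
| distr_in_g s a a' :
    skeleton L s (Op_g a) -> distr (child_sign (eta_g sg) s) a a' ->
    distr s (Op_g a) (Op_g a')
| distr_in_k s (ts : 'I_(arity_k sg) -> term sg) i u :
    skeleton L s (Op_k ts) -> distr (child_sign (eps_k i) s) (ts i) u ->
    distr s (Op_k ts) (Op_k (update ts i u))
| distr_in_l s (ts : 'I_(arity_l sg) -> term sg) i u :
    skeleton L s (Op_l ts) -> distr (child_sign (eps_l i) s) (ts i) u ->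
    distr s (Op_l ts) (Op_l (update ts i u))
| distr_in_imp_l s a a' b :
    skeleton L s (Imp a b) -> distr (~~ s) a a' ->
    distr s (Imp a b) (Imp a' b)
| distr_in_imp_r s a b b' :
    skeleton L s (Imp a b) -> distr s b b' -> distr s (Imp a b) (Imp a b').

(* Variable elimination asks for an occurrence of p, so that exhaustive
   application makes sense. *)
Inductive prep_rule : ineq sg -> seq (ineq sg) -> Prop :=
| prep_distr_l a a' b : distr true a a' -> prep_rule (a, b) [:: (a', b)]
| prep_distr_r a b b' : distr false b b' -> prep_rule (a, b) [:: (a, b')]
| prep_split_and a b c : prep_rule (a, And b c) [:: (a, b); (a, c)]
| prep_split_or a b c : prep_rule (Or a b, c) [:: (a, c); (b, c)]
| prep_elim_bot p a b :
    p \in vars a ++ vars b -> negative p a -> positive p b ->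
    prep_rule (a, b) [:: (subst p Bot a, subst p Bot b)]
| prep_elim_top p a b :
    p \in vars a ++ vars b -> positive p a -> negative p b ->
    prep_rule (a, b) [:: (subst p Top a, subst p Top b)].

Inductive prep_step : seq (ineq sg) -> seq (ineq sg) -> Prop :=
| PrepStep E1 x ys E2 :
    prep_rule x ys -> prep_step (E1 ++ x :: E2) (E1 ++ ys ++ E2).

(* E is a result of the exhaustive application of the preprocessing steps. *)
Definition preprocess (phi psi : term sg) (E : seq (ineq sg)) : Prop :=
  clos_refl_trans _ prep_step [:: (phi, psi)] E /\
  forall E', ~ prep_step E E'.

End Preprocessing.

(* [side] marks the side conditions introduced by the adjunction rules. *)
Record constr (sg : signature) := Constr {
  lhs : term sg;
  rhs : term sg;
  side : bool
}.

Definition system (sg : signature) : Type := seq (constr sg).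

Section Reduction.

Variables (sg : signature) (L : logic).
Implicit Types (a b c t u : term sg) (p x y : nat) (S : system sg).

Definition plain a b : constr sg := Constr a b false.
Definition side_condition a b : constr sg := Constr a b true.

(* The name 0 is reserved for the nominal i_0 and the conominal m_0. *)
Definition initial_system (e : ineq sg) : system sg :=
  [:: plain (Nom 0) e.1; plain e.2 (Conom 0)].

Definition fresh S x : bool :=
  (x != 0) && all (fun d => x \notin names (lhs d) ++ names (rhs d)) S.

(* The alternative for i <= k(ts) given by Q, the union of the sets P and N of
   coordinates of order type 1 and dual respectively; the coordinate e is named
   by v e. *)
Definition approx_k (i : nat) (ts : 'I_(arity_k sg) -> term sg)
    (v : 'I_(arity_k sg) -> nat) (Q : {set 'I_(arity_k sg)}) : system sg :=
  plain (Nom i)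
        (Op_k (fun e => if e \in Q
                        then (if eps_k e then Nom (v e) else Conom (v e))
                        else (if eps_k e then Bot else Top)))
  :: [seq (if eps_k e then plain (Nom (v e)) (ts e)
           else plain (ts e) (Conom (v e))) | e <- enum Q].

Definition approx_l (m : nat) (ts : 'I_(arity_l sg) -> term sg)
    (v : 'I_(arity_l sg) -> nat) (Q : {set 'I_(arity_l sg)}) : system sg :=
  plain (Op_l (fun e => if e \in Q
                        then (if eps_l e then Conom (v e) else Nom (v e))
                        else (if eps_l e then Top else Bot)))
        (Conom m)
  :: [seq (if eps_l e then plain (ts e) (Conom (v e))
           else plain (Nom (v e)) (ts e)) | e <- enum Q].

(* [rule S a b alts]: in the system S the inequality a <= b may be replaced by
   any of the alternatives in alts.  The residuation rules are stated up to
   commutativity of /\ and \/. *)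
Inductive rule (S : system sg) : term sg -> term sg -> seq (system sg) -> Prop :=
| split_and a b c :
    rule S a (And b c) [:: [:: plain a b; plain a c]]
| split_or a b c :
    rule S (Or a b) c [:: [:: plain a c; plain b c]]
| resid_and_l a b c : rule S (And a b) c [:: [:: plain b (Imp a c)]]
| resid_and_r a b c : rule S (And a b) c [:: [:: plain a (Imp b c)]]
| resid_imp a b c : is_har L ->
    rule S b (Imp a c) [:: [:: plain (And a b) c]]
| resid_or_l a b c : rule S a (Or b c) [:: [:: plain (Diff a c) b]]
| resid_or_r a b c : rule S a (Or b c) [:: [:: plain (Diff a b) c]]
| adj_f_mon a b : eta_f sg ->
    rule S (Op_f a) b
      [:: [:: side_condition (Op_f Bot) b; plain a (Adj_f b)]]
| adj_f_ant a b : ~~ eta_f sg ->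
    rule S (Op_f a) b
      [:: [:: side_condition (Op_f Top) b; plain (Adj_f b) a]]
| adj_g_mon a b : eta_g sg ->
    rule S a (Op_g b)
      [:: [:: side_condition a (Op_g Top); plain (Adj_g a) b]]
| adj_g_ant a b : ~~ eta_g sg ->
    rule S a (Op_g b)
      [:: [:: side_condition a (Op_g Bot); plain b (Adj_g a)]]
| approx_f_mon i a x : eta_f sg -> fresh S x ->
    rule S (Nom i) (Op_f a)
      [:: [:: plain (Nom i) (Op_f Bot)];
          [:: plain (Nom x) a; plain (Nom i) (Op_f (Nom x))]]
| approx_f_ant i a x : ~~ eta_f sg -> fresh S x ->
    rule S (Nom i) (Op_f a)
      [:: [:: plain (Nom i) (Op_f Top)];
          [:: plain a (Conom x); plain (Nom i) (Op_f (Conom x))]]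
| approx_g_mon m a x : eta_g sg -> fresh S x ->
    rule S (Op_g a) (Conom m)
      [:: [:: plain (Op_g Top) (Conom m)];
          [:: plain a (Conom x); plain (Op_g (Conom x)) (Conom m)]]
| approx_g_ant m a x : ~~ eta_g sg -> fresh S x ->
    rule S (Op_g a) (Conom m)
      [:: [:: plain (Op_g Bot) (Conom m)];
          [:: plain (Nom x) a; plain (Op_g (Nom x)) (Conom m)]]
| approx_k_all i (ts : 'I_(arity_k sg) -> term sg) v :
    injective v -> (forall e, fresh S (v e)) ->
    rule S (Nom i) (Op_k ts)
      [seq approx_k i ts v Q | Q <- enum {set 'I_(arity_k sg)}]
| approx_l_all m (ts : 'I_(arity_l sg) -> term sg) v :
    injective v -> (forall e, fresh S (v e)) ->
    rule S (Op_l ts) (Conom m)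
      [seq approx_l m ts v Q | Q <- enum {set 'I_(arity_l sg)}]
| approx_imp a b m x y : is_har L -> fresh S x -> fresh S y ->
    rule S (Imp a b) (Conom m)
      [:: [:: plain (Nom x) a; plain b (Conom y);
              plain (Imp (Nom x) (Conom y)) (Conom m)]].

Definition subst_constr p u (d : constr sg) : constr sg :=
  Constr (subst p u (lhs d)) (subst p u (rhs d)) (side d).

(* [reduce S A Ss]: one application of a rule to the system S yields the
   systems Ss; A lists the inequalities of S that are replaced, as opposed to
   being kept or merely receiving an Ackermann substitution.  In the Ackermann
   rules the inequalities alpha <= p (resp. p <= alpha) are necessarily all the
   ones with right-hand (resp. left-hand) side p, since p is not negative
   in p. *)
Inductive reduce : system sg -> system sg -> seq (system sg) -> Prop :=
| reduce_rule S1 d S2 alts :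
    rule (S1 ++ d :: S2) (lhs d) (rhs d) alts ->
    reduce (S1 ++ d :: S2) [:: d] [seq S1 ++ B ++ S2 | B <- alts]
| ackermann_right p S :
    let A := [seq d <- S | is_var p (rhs d)] in
    let R := [seq d <- S | ~~ is_var p (rhs d)] in
    all (fun d => p \notin vars (lhs d)) A ->
    all (fun d => positive p (lhs d) && negative p (rhs d)) R ->
    reduce S A
      [:: [seq subst_constr p (bigjoin [seq lhs d' | d' <- A]) d | d <- R]]
| ackermann_left p S :
    let A := [seq d <- S | is_var p (lhs d)] in
    let R := [seq d <- S | ~~ is_var p (lhs d)] in
    all (fun d => p \notin vars (rhs d)) A ->
    all (fun d => negative p (lhs d) && positive p (rhs d)) R ->
    reduce S A
      [:: [seq subst_constr p (bigmeet [seq rhs d' | d' <- A]) d | d <- R]].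

(* [run G As G']: the list of systems G is transformed into G' by successive
   rule applications, the n-th of which replaces the inequalities in the n-th
   element of As. *)
Inductive run :
  seq (system sg) -> seq (system sg) -> seq (system sg) -> Prop :=
| run_nil G : run G [::] G
| run_cons G1 S G2 A Ss As G' :
    reduce S A Ss -> run (G1 ++ Ss ++ G2) As G' ->
    run (G1 ++ S :: G2) (A :: As) G'.

End Reduction.

Record execution (sg : signature) (L : logic) (phi psi : term sg) := Execution {
  preprocessed : seq (ineq sg);
  replaced : seq (system sg);
  final : seq (system sg);
  execution_preprocess : preprocess L phi psi preprocessed;
  execution_run :
    run L [seq initial_system e | e <- preprocessed] replaced final
}.

Definition pure (sg : signature) (t : term sg) : bool := nilp (vars t).

Definition successful (sg : signature) (L : logic) (phi psi : term sg)
    (x : execution L phi psi) : bool :=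
  all (all (fun d => pure (lhs d) && pure (rhs d))) (final x).

Definition safe (sg : signature) (L : logic) (phi psi : term sg)
    (x : execution L phi psi) : bool :=
  all (all (fun d => ~~ side d)) (replaced x).

(* Main.v *)
(* Preprocessing terminates, keeps the inequality inductive and leaves no +\/
   or -/\ in the Skeleton part of the trees.  Approximation and splitting
   therefore strip off the Skeleton part, leaving inequalities i <= t and
   t <= m with t a PIA tree.  Residuation, adjunction and splitting follow the
   critical branches of t down to their leaves p, producing minimal valuations
   alpha <= p or p <= alpha.  Throughout, the side r of the inequality that
   faces the term t under reduction agrees with eps, and all its variables are
   below p in Omega for each critical leaf p of t.

   The side conditions, like the inequalities without critical leaves, agree
   with eps on both sides; hence none of them has the form alpha <= p with eps p = 1 or
   p <= alpha with eps p = dual, and the Ackermann rules never consume them.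
   Since Omega is irreflexive and transitive, substituting a minimal valuation
   preserves this invariant, so the variables can be eliminated in any order. *)

From Stdlib Require Import Relations Classical.
From Stdlib Require List.
Require Import Defs.
From mathcomp Require Import all_boot.

Set Implicit Arguments.
Unset Strict Implicit.
Unset Printing Implicit Defensive.

(** * Signed generation trees *)

Section SignedTreeTheory.

Variable sg : signature.
Implicit Types (a b t u : term sg) (p q : nat) (s o : bool).

(** The coordinate is forgotten, so that the families below [Op_k] and [Op_l] are handled like the
    arguments of the other connectives. *)
Definition child t o u : Prop := exists c, onth (children t) c = Some (o, u).

Lemma child_k (ts : 'I_(arity_k sg) -> term sg) i :
  child (Op_k ts) (eps_k i) (ts i).
Proof.
have /onthP[c ci] : i \in enum 'I_(arity_k sg) by rewrite mem_enum.
by exists c; rewrite /= onth_map ci.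
Qed.

Lemma child_l (ts : 'I_(arity_l sg) -> term sg) i :
  child (Op_l ts) (eps_l i) (ts i).
Proof.
have /onthP[c ci] : i \in enum 'I_(arity_l sg) by rewrite mem_enum.
by exists c; rewrite /= onth_map ci.
Qed.

Lemma child_kP (ts : 'I_(arity_k sg) -> term sg) o u :
  child (Op_k ts) o u -> exists i, o = eps_k i /\ u = ts i.
Proof. by case=> c /=; rewrite onth_map; case: onth => //= i [<- <-]; exists i. Qed.

Lemma child_lP (ts : 'I_(arity_l sg) -> term sg) o u :
  child (Op_l ts) o u -> exists i, o = eps_l i /\ u = ts i.
Proof. by case=> c /=; rewrite onth_map; case: onth => //= i [<- <-]; exists i. Qed.

Lemma childP t o u : child t o u ->
  match children t with
  | [:: x] => (o, u) = x
  | [:: x; y] => (o, u) = x \/ (o, u) = y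
  | [::] => False
  | _ => True
  end.
Proof.
case=> c; case: (children t) => [|x [|y [|z xs]]] //.
- by rewrite onth0n.
- by move/onth1P => -[_ ->].
- by case: c => [|[|c]] /=; rewrite ?onth0n // => -[->]; [left | right].
Qed.

(** Structural induction has one case per connective; induction along [child] treats them uniformly,
    as arguments about branches require. *)
Lemma term_child_ind (P : term sg -> Prop) :
  (forall t, (forall o u, child t o u -> P u) -> P t) -> forall t, P t.
Proof.
move=> H; elim=> [p|x|x|||a IHa b IHb|a IHa b IHb|a IHa|a IHa|ts IH|ts IH
    |a IHa b IHb|a IHa b IHb|a IHa|a IHa]; apply: H => o u.
1-5: by move/childP => /=.
1,2,7,8: by move/childP => /= -[] [_ ->].
1,2,5,6: by move/childP => /= -[_ ->].
- by case/child_kP => i [_ ->].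
- by case/child_lP => i [_ ->].
Qed.

Lemma leavesE s t :
  leaves s t = if t is Var p then [:: (s, p)]
               else flatten [seq leaves (child_sign x.1 s) x.2 | x <- children t].
Proof. by case: t => //= *; rewrite ?cats0 // -map_comp. Qed.

Lemma mem_flatten_onth (T : Type) (U : eqType) (f : T -> seq U) xs y :
  y \in flatten (map f xs) <-> exists c x, onth xs c = Some x /\ y \in f x.
Proof.
elim: xs => [|x xs IH] /=; first by split=> // -[c [x]]; rewrite onth0n => -[].
rewrite mem_cat; split.
  case/orP => [yx|/IH[c [z [cz yz]]]]; first by exists 0, x.
  by exists c.+1, z.
case=> -[|c] [z] /= [cz yz]; first by case: cz => ->; rewrite yz.
by apply/orP; right; apply/IH; exists c, z.
Qed.

Lemma leaves_child s t o u l :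
  child t o u -> l \in leaves (child_sign o s) u -> l \in leaves s t.
Proof.
case=> c cu lu; rewrite leavesE.
have step : l \in flatten [seq leaves (child_sign x.1 s) x.2 | x <- children t].
  by apply/mem_flatten_onth; exists c, (o, u).
by case: t cu step.
Qed.

(** Bridge from the computed list of leaves to branches: a condition on critical branches can be
    applied as soon as a critical leaf is known. *)
Lemma leaves_branch s t l : l \in leaves s t -> exists ns, branch s t ns l.1 l.2.
Proof.
elim/term_child_ind: t s => t IH s; rewrite leavesE.
have step : l \in flatten [seq leaves (child_sign x.1 s) x.2 | x <- children t] ->
    exists ns, branch s t ns l.1 l.2.
  case/mem_flatten_onth => c [[o u] [cu lu]].
  have [ns br] := IH o u (ex_intro _ c cu) _ lu.
  by exists ((s, t, c) :: ns); apply: branch_node cu br.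
case: t {IH} step => // p _; rewrite inE => /eqP ->.
by exists [::]; constructor.
Qed.

Lemma leavesN s t : leaves (~~ s) t = [seq (~~ l.1, l.2) | l <- leaves s t].
Proof.
have csN o s' : child_sign o (~~ s') = ~~ child_sign o s' by case: o.
elim: t s => //= [a IHa b IHb|a IHa b IHb|a IHa|a IHa|ts IH|ts IH
    |a IHa b IHb|a IHa b IHb|a IHa|a IHa] s; rewrite ?map_cat ?csN ?IHa ?IHb //.
- rewrite map_flatten -map_comp; congr flatten; apply: eq_map => i /=.
  by rewrite csN IH.
- rewrite map_flatten -map_comp; congr flatten; apply: eq_map => i /=.
  by rewrite csN IH.
Qed.

(** Switching the root sign switches the sign of every leaf but keeps the labels. *)
Lemma vars_leaves s t : vars t = unzip2 (leaves s t).
Proof.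
by case: s => //; rewrite /vars (leavesN false) /unzip2 -map_comp.
Qed.

Lemma vars_cat s1 s2 a b :
  unzip2 (leaves s1 a ++ leaves s2 b) = vars a ++ vars b.
Proof. by rewrite (vars_leaves s1) (vars_leaves s2) /unzip2 map_cat. Qed.

Lemma mem_vars s s' t p : (s', p) \in leaves s t -> p \in vars t.
Proof. by rewrite (vars_leaves s) => h; apply/mapP; exists (s', p). Qed.

(** * Substitution, agreement with an order type, and polarity *)

Lemma leaves_subst s p u t :
  leaves s (subst p u t) =
  flatten [seq if l.2 == p then leaves l.1 u else [:: l] | l <- leaves s t].
Proof.
have flatK n (F : 'I_n -> seq (bool * nat)) (G : bool * nat -> seq (bool * nat)) :
    flatten [seq G l | l <- flatten [seq F i | i <- enum 'I_n]] =
    flatten [seq flatten [seq G l | l <- F i] | i <- enum 'I_n].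
  by elim: (enum _) => //= i e IH; rewrite map_cat flatten_cat IH.
elim: t s => //= [q|a IHa b IHb|a IHa b IHb|ts IH|ts IH
    |a IHa b IHb|a IHa b IHb] s; rewrite ?map_cat ?flatten_cat ?IHa ?IHb //.
- by case: ifP => //= _; rewrite cats0.
- by rewrite flatK; congr flatten; apply: eq_map => i; rewrite IH.
- by rewrite flatK; congr flatten; apply: eq_map => i; rewrite IH.
Qed.

Lemma leaves_subst_closed s p u t : (forall s', leaves s' u = [::]) ->
  leaves s (subst p u t) = [seq l <- leaves s t | l.2 != p].
Proof.
move=> u0; rewrite leaves_subst; elim: (leaves s t) => //= l ls ->.
by case: ifP; rewrite ?u0.
Qed.

Lemma agreesN eps s t : agrees (dual eps) (~~ s) t = agrees eps s t.
Proof.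
rewrite /agrees leavesN all_map; apply: eq_all => l.
by rewrite /critical /dual /=; case: l.1; case: eps.
Qed.

Lemma agreesNs eps s t : agrees eps (~~ s) t = agrees (dual eps) s t.
Proof. by rewrite -{2}(negbK s) agreesN. Qed.

(** All leaves p of t have sign [eps p], so every copy of u planted there has root sign [eps p]. *)
Lemma agrees_subst eps s p u t :
  agrees eps s t -> agrees eps (eps p) u -> agrees eps s (subst p u t).
Proof.
move=> /allP ht /allP hu; apply/allP => l; rewrite leaves_subst.
case/flatten_mapP => -[s' q] /= /[dup] /ht /eqP /= -> qt.
by case: eqP => [->|_]; [apply: hu | rewrite inE => /eqP ->; apply: eqxx].
Qed.

Lemma vars_subst p u t q :
  q \in vars (subst p u t) -> (q \in vars t /\ q != p) \/ (q \in vars u /\ p \in vars t).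
Proof.
rewrite (vars_leaves true) => /mapP[[s q'] /= + ->]; rewrite leaves_subst.
case/flatten_mapP => -[s' r] lr /=; have rt := mem_vars lr.
case: eqP => [<-|/eqP rp]; first by move/mem_vars; right.
by rewrite inE => /eqP[_ ->]; left.
Qed.

(** This lemma and the next three supply the polarity premises of the Ackermann rules: the right
    rule when [eps p] holds, the left rule otherwise. *)
Lemma positive_agrees eps p t : agrees eps true t -> eps p -> positive p t.
Proof.
move=> /allP h e; apply/allP => -[s q] /h /eqP /= ->.
by apply/implyP => /eqP ->.
Qed.

Lemma negative_agrees eps p t : agrees eps false t -> eps p -> negative p t.
Proof.
move=> h e; rewrite -[false]/(~~ true) agreesNs in h.
apply/allP => -[s q] /(allP h) /eqP /= ->; rewrite /dual negbK.
by apply/implyP => /eqP ->.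
Qed.

Lemma positive_agreesN eps p t : agrees eps false t -> ~~ eps p -> positive p t.
Proof.
move=> h e; rewrite -[false]/(~~ true) agreesNs in h.
apply/allP => -[s q] /(allP h) /eqP /= ->; rewrite /dual.
by apply/implyP => /eqP ->.
Qed.

Lemma negative_agreesN eps p t : agrees eps true t -> ~~ eps p -> negative p t.
Proof.
move=> /allP h e; apply/allP => -[s q] /h /eqP /= ->.
by apply/implyP => /eqP ->.
Qed.

End SignedTreeTheory.

(** * Termination of preprocessing *)

Section PreprocessingTermination.

Variables (sg : signature) (L : logic).
Implicit Types (a b t u : term sg) (p : nat) (s : bool).

(* Sum at +\/ and -/\, twice the product at the other Skeleton nodes, so that
   distribution decreases the weight; counting the variable leaves below the
   Skeleton part makes variable elimination decrease it as well. *)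
Fixpoint weight s t : nat :=
  match t with
  | And a b => if s then 2 * (weight s a * weight s b)
               else (weight s a + weight s b).+1
  | Or a b => if s then (weight s a + weight s b).+1
              else 2 * (weight s a * weight s b)
  | Op_f a => if s then 2 * weight (child_sign (eta_f sg) s) a
              else (size (leaves s t)).+1
  | Op_g a => if s then (size (leaves s t)).+1
              else 2 * weight (child_sign (eta_g sg) s) a
  | Op_k ts => if s then 2 * \prod_i weight (child_sign (eps_k i) s) (ts i)
               else (size (leaves s t)).+1
  | Op_l ts => if s then (size (leaves s t)).+1
               else 2 * \prod_i weight (child_sign (eps_l i) s) (ts i)
  | Imp a b => if is_har L && ~~ s then 2 * (weight (~~ s) a * weight s b)
               else (size (leaves s t)).+1
  | _ => (size (leaves s t)).+1
  end.

Lemma weight_gt0 s t : 0 < weight s t.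
Proof.
elim: t s => //= [a IHa b IHb|a IHa b IHb|a IHa|a IHa|ts IH|ts IH
    |a IHa b IHb] s; case: ifP => // _; rewrite ?muln_gt0 ?IHa ?IHb //=;
  exact: prodn_gt0.
Qed.

Lemma leq_prodn n (F G : 'I_n -> nat) :
  (forall i, F i <= G i) -> \prod_i F i <= \prod_i G i.
Proof. by move=> FG; apply: leq_prod => i _; apply: FG. Qed.

Lemma ltn_prodn n (F G : 'I_n -> nat) i :
  (forall j, 0 < G j) -> (forall j, F j <= G j) -> F i < G i ->
  \prod_j F j < \prod_j G j.
Proof.
move=> G0 FG Fi; rewrite (bigD1 i) //= [ltnRHS](bigD1 i) //=.
apply: (@leq_ltn_trans (F i * \prod_(j | j != i) G j)).
  by rewrite leq_mul2l leq_prod ?orbT.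
by rewrite ltn_pmul2r // prodn_gt0.
Qed.

Lemma weight_or a b : weight true (Or a b) = (weight true a + weight true b).+1.
Proof. by []. Qed.

Lemma weight_and a b :
  weight false (And a b) = (weight false a + weight false b).+1.
Proof. by []. Qed.

Lemma weight_k ts i : weight true (Op_k ts) =
  2 * (weight (child_sign (eps_k i) true) (ts i) *
       \prod_(j | j != i) weight (child_sign (eps_k j) true) (ts j)).
Proof. by rewrite /= (bigD1 i). Qed.

Lemma weight_l ts i : weight false (Op_l ts) =
  2 * (weight (child_sign (eps_l i) false) (ts i) *
       \prod_(j | j != i) weight (child_sign (eps_l j) false) (ts j)).
Proof. by rewrite /= (bigD1 i). Qed.

Lemma weight_k_update ts i u : weight true (Op_k (update ts i u)) =
  2 * (weight (child_sign (eps_k i) true) u *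
       \prod_(j | j != i) weight (child_sign (eps_k j) true) (ts j)).
Proof.
rewrite (weight_k _ i) /update eqxx; congr (_ * (_ * _)).
by apply: eq_bigr => j /negPf ->.
Qed.

Lemma weight_l_update ts i u : weight false (Op_l (update ts i u)) =
  2 * (weight (child_sign (eps_l i) false) u *
       \prod_(j | j != i) weight (child_sign (eps_l j) false) (ts j)).
Proof.
rewrite (weight_l _ i) /update eqxx; congr (_ * (_ * _)).
by apply: eq_bigr => j /negPf ->.
Qed.

Lemma prod_weight_gt0 n (Q : pred 'I_n) (F : 'I_n -> bool) ts :
  0 < \prod_(j | Q j) weight (F j) (ts j).
Proof. by apply: prodn_gt0 => j; apply: weight_gt0. Qed.

(** Here x and y are the weights of the two arguments of the crossed node and z is the product over
    the untouched coordinates. The successor in the weight of the crossed node contributes 2z, which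
    exceeds the single new successor. *)
Lemma weight_distr x y z : 0 < z ->
  (2 * (x * z) + 2 * (y * z)).+1 < 2 * ((x + y).+1 * z).
Proof.
move=> z0; rewrite -mulnDr -mulnDl (mulSnr (x + y)) mulnDr -addn1 ltn_add2l.
exact: leq_pmulr.
Qed.

Lemma weight_distr_root s t t' : distr_root L s t t' -> weight s t' < weight s t.
Proof.
have wf x y z : weight s t' = (2 * (x * z) + 2 * (y * z)).+1 -> 0 < z ->
    weight s t = 2 * ((x + y).+1 * z) -> weight s t' < weight s t.
  by move=> -> z0 ->; apply: weight_distr.
move=> d; case: d wf => [a b c|a b c|a b c|a b c|a b e|a b e|a b e|a b e
  |ts i a b e ti|ts i a b e ti|ts i a b e ti|ts i a b e ti|a b c h|a b c h] wf.
- exact: wf erefl (weight_gt0 _ _) erefl.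
- apply: (wf (weight true b) (weight true c) _ _ (weight_gt0 true a)) => /=.
    by rewrite !(mulnC (weight true a)).
  by rewrite (mulnC (weight true a)).
- exact: wf erefl (weight_gt0 _ _) erefl.
- apply: (wf (weight false b) (weight false c) _ _ (weight_gt0 false a)) => /=.
    by rewrite !(mulnC (weight false a)).
  by rewrite (mulnC (weight false a)).
(* A unary operator has no untouched coordinate, so the third factor is the empty product 1. *)
1-4: by apply: (wf _ _ 1); rewrite /= ?e ?(negPf e) ?muln1.
1,2: by apply: wf (prod_weight_gt0 _ _ _) _;
  [rewrite weight_or !weight_k_update | rewrite (weight_k _ i) ti];
  rewrite ?e ?(negPf e).
1,2: by apply: wf (prod_weight_gt0 _ _ _) _;
  [rewrite weight_and !weight_l_update | rewrite (weight_l _ i) ti];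
  rewrite ?e ?(negPf e).
- by apply: wf (weight_gt0 false c) _; rewrite /= h.
- apply: (wf (weight false b) (weight false c) _ _ (weight_gt0 true a)) => /=.
    by rewrite h /= !(mulnC (weight true a)).
  by rewrite h /= (mulnC (weight true a)).
Qed.

Lemma weight_distr_step s t t' : distr L s t t' -> weight s t' < weight s t.
Proof.
elim=> {s t t'} [s t t'|s a a' b|s a b b'|s a a' b|s a b b'|s a a'|s a a'
  |s ts i u|s ts i u|s a a' b|s a b b']; first exact: weight_distr_root.
1-4: by case: s => /= _ _ IH; rewrite ?ltnS ?ltn_add2r ?ltn_add2l ?ltn_pmul2l
  ?(ltn_pmul2r, ltn_pmul2l) ?weight_gt0.
1,2: by case: s => //= _ _ IH; rewrite ltn_pmul2l.
- case: s => // _ _ IH.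
  by rewrite weight_k_update (weight_k ts i) ltn_pmul2l // ltn_pmul2r ?prod_weight_gt0.
- case: s => // _ _ IH.
  by rewrite weight_l_update (weight_l ts i) ltn_pmul2l // ltn_pmul2r ?prod_weight_gt0.
all: by move=> /= -> _ IH; rewrite !(ltn_pmul2r, ltn_pmul2l) ?weight_gt0.
Qed.

(** * Variable elimination decreases the weight *)

Definition constant u : Prop := u = Top \/ u = Bot.

Lemma leaves_constant u : constant u -> forall s, leaves s u = [::].
Proof. by case=> ->. Qed.

Lemma size_leaves_subst s p u t : constant u ->
  size (leaves s (subst p u t)) <= size (leaves s t).
Proof.
by move=> cu; rewrite leaves_subst_closed ?size_filter ?count_size //; apply: leaves_constant.
Qed.

Lemma ltn_size_leaves_subst s p u t : constant u -> p \in vars t ->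
  size (leaves s (subst p u t)) < size (leaves s t).
Proof.
move=> cu; rewrite (vars_leaves s) leaves_subst_closed; last exact: leaves_constant.
case/mapP => l lt ->; rewrite size_filter -[ltnRHS](count_predC (fun x => x.2 != l.2)).
rewrite -[ltnLHS]addn0 ltn_add2l -has_count; apply/hasP; exists l => //=.
by rewrite eqxx.
Qed.

Lemma weight_subst s p u t : constant u -> weight s (subst p u t) <= weight s t.
Proof.
move=> cu; elim: t s => /= [q|x|x|||a IHa b IHb|a IHa b IHb|a IHa|a IHa|ts IH|ts IH
    |a IHa b IHb|a _ b _|a _|a _] s //.
- by case: cu => ->; case: ifP.
1,2: by case: s; rewrite ?ltnS ?leq_mul ?leq_add.
- by case: s; rewrite ?leq_mul ?ltnS ?size_leaves_subst.
- by case: s; rewrite ?leq_mul ?ltnS ?size_leaves_subst.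
- case: s; last exact: (@size_leaves_subst false p u (Op_k ts)).
  by rewrite leq_mul // leq_prodn.
- case: s; first exact: (@size_leaves_subst true p u (Op_l ts)).
  by rewrite leq_mul // leq_prodn.
- case: ifP => _; first by rewrite !leq_mul.
  exact: (@size_leaves_subst s p u (Imp a b)).
- exact: (@size_leaves_subst s p u (Diff a b)).
- exact: (@size_leaves_subst s p u (Adj_f a)).
- exact: (@size_leaves_subst s p u (Adj_g a)).
Qed.

Lemma ltn_mul_or m m' n n' : m' <= m -> n' <= n -> 0 < m -> 0 < n ->
  (m' < m) || (n' < n) -> m' * n' < m * n.
Proof.
move=> mm nn m0 n0 /orP[lt|lt].
  by apply: (@leq_ltn_trans (m' * n)); rewrite ?leq_mul2l ?nn ?orbT ?ltn_pmul2r.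
by apply: (@leq_ltn_trans (m * n')); rewrite ?leq_mul2r ?mm ?orbT ?ltn_pmul2l.
Qed.

(** Below the Skeleton part the number of leaves drops; above it all weights are positive, so a
    strict decrease in one coordinate survives sums and products. *)
Lemma ltn_weight_subst s p u t : constant u -> p \in vars t ->
  weight s (subst p u t) < weight s t.
Proof.
move=> cu; have le s' t' := @weight_subst s' p u t' cu.
have ls s' t' := @ltn_size_leaves_subst s' p u t' cu.
have lt_add s1 a s2 b : (p \in vars a -> weight s1 (subst p u a) < weight s1 a) ->
    (p \in vars b -> weight s2 (subst p u b) < weight s2 b) ->
    p \in vars a ++ vars b ->
    (weight s1 (subst p u a) + weight s2 (subst p u b)).+1 <
    (weight s1 a + weight s2 b).+1.
  move=> ha hb; rewrite mem_cat ltnS => /orP[/ha h|/hb h].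
    by rewrite -addSn leq_add.
  by rewrite -addnS leq_add.
have lt_mul s1 a s2 b : (p \in vars a -> weight s1 (subst p u a) < weight s1 a) ->
    (p \in vars b -> weight s2 (subst p u b) < weight s2 b) ->
    p \in vars a ++ vars b ->
    2 * (weight s1 (subst p u a) * weight s2 (subst p u b)) <
    2 * (weight s1 a * weight s2 b).
  move=> ha hb pab; rewrite ltn_pmul2l // ltn_mul_or ?weight_gt0 //.
  by move: pab; rewrite mem_cat => /orP[/ha|/hb] ->; rewrite ?orbT.
have vflat n (F : 'I_n -> bool) (ts : 'I_n -> term sg) :
    p \in unzip2 (flatten [seq leaves (F i) (ts i) | i <- enum 'I_n]) ->
    exists i, p \in vars (ts i).
  case/mapP => -[s' q] /flatten_mapP[i _ /mem_vars h] ->.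
  by exists i.
elim: t s => /= [q|x|x|||a IHa b IHb|a IHa b IHb|a IHa|a IHa|ts IH|ts IH
    |a IHa b IHb|a _ b _|a _|a _] s //.
- by rewrite inE eq_sym; case: cu => -> ->.
- by rewrite /vars /= vars_cat; case: s; auto.
- by rewrite /vars /= vars_cat; case: s; auto.
- case: s; last exact: (ls false (Op_f a)).
  by rewrite /vars /= -vars_leaves ltn_pmul2l //; apply: IHa.
- case: s; first exact: (ls true (Op_g a)).
  by rewrite /vars /= -vars_leaves ltn_pmul2l //; apply: IHa.
- case: s; last exact: (ls false (Op_k ts)).
  case/vflat => i /IH lt; rewrite ltn_pmul2l //.
  by apply: (@ltn_prodn _ _ _ i) => // j; apply: weight_gt0.
- case: s; first exact: (ls true (Op_l ts)).
  case/vflat => i /IH lt; rewrite ltn_pmul2l //.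
  by apply: (@ltn_prodn _ _ _ i) => // j; apply: weight_gt0.
- case: ifP => _; last exact: (ls s (Imp a b)).
  by rewrite /vars /= vars_cat; auto.
- exact: (ls s (Diff a b)).
- exact: (ls s (Adj_f a)).
- exact: (ls s (Adj_g a)).
Qed.

(** A product, because splitting copies one side: the sum over both copies falls short of the old
    product by the weight of the copied side, owing to the successor in the weight of +\/ and
    -/\. *)
Definition ineq_weight (e : ineq sg) : nat := weight true e.1 * weight false e.2.

Lemma prep_rule_weight e ys : prep_rule L e ys ->
  sumn [seq ineq_weight y | y <- ys] < ineq_weight e.
Proof.
case=> [a a' b d|a b b' d|a b c|a b c|p a b|p a b] /=; rewrite /ineq_weight /= ?addn0.
- by rewrite ltn_pmul2r ?weight_gt0 ?weight_distr_step.
- by rewrite ltn_pmul2l ?weight_gt0 ?weight_distr_step.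
- by rewrite -mulnDr ltn_pmul2l ?weight_gt0.
- by rewrite -mulnDl ltn_pmul2r ?weight_gt0.
- rewrite mem_cat => h _ _; apply: ltn_mul_or; rewrite ?weight_gt0 ?weight_subst //; try by right.
  by case/orP: h => h; rewrite ?(ltn_weight_subst _ (or_intror erefl) h) ?orbT.
- rewrite mem_cat => h _ _; apply: ltn_mul_or; rewrite ?weight_gt0 ?weight_subst //; try by left.
  by case/orP: h => h; rewrite ?(ltn_weight_subst _ (or_introl erefl) h) ?orbT.
Qed.

Lemma prep_step_weight E E' : prep_step L E E' ->
  sumn [seq ineq_weight e | e <- E'] < sumn [seq ineq_weight e | e <- E].
Proof.
case=> E1 x ys E2 /prep_rule_weight xys.
by rewrite !map_cat !sumn_cat /= ltn_add2l ltn_add2r.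
Qed.

Lemma exhaustive_preprocessing (E : seq (ineq sg)) : exists E',
  clos_refl_trans _ (prep_step L) E E' /\ forall E'', ~ prep_step L E' E''.
Proof.
move: {2}_.+1 (ltnSn (sumn [seq ineq_weight e | e <- E])) => n.
elim: n E => // n IH E; rewrite ltnS => En.
(* Excluded middle decides whether some step still applies; the total weight bounds the number of
   steps. *)
case: (classic (exists E', prep_step L E E')) => [[E1 st]|no].
  have [E' [E1E' nf]] := IH _ (leq_trans (prep_step_weight st) En).
  by exists E'; split=> //; apply: rt_trans E1E'; apply: rt_step.
by exists E; split=> [|E' st]; [apply: rt_refl | apply: no; exists E'].
Qed.

End PreprocessingTermination.

(** * Preservation of inductivity *)

Section InductiveTrees.

Variables (sg : signature) (L : logic) (Om : rel nat) (eps : nat -> bool).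
Implicit Types (a b t u : term sg) (p q : nat) (s o : bool).

Local Notation inductive := (@inductive_tree sg L Om eps).

Lemma branch_childP s t ns s' p : branch s t ns s' p ->
  (exists2 q, t = Var q & ns = [::]) \/
  exists c o u ns', [/\ onth (children t) c = Some (o, u), ns = (s, t, c) :: ns' &
    branch (child_sign o s) u ns' s' p].
Proof.
case=> [s1 q|s1 t1 c o u ns1 s2 q cu br]; first by left; exists q.
by right; exists c, o, u, ns1.
Qed.

(** Prefixing the root to a branch of u gives a branch of t. Removing the root from its
    decomposition shortens P2, or P1 if P2 is empty, and all conditions survive. *)
Lemma inductive_child s t o u :
  inductive s t -> child t o u -> inductive (child_sign o s) u.
Proof.
move=> ind [c cu] ns s' p br cr.
case: (ind _ _ _ (branch_node cu br) cr) => -[|nd P2] [P1 [/= eq sk pi sr]].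
  by exists [::], ns; split=> //; [move: pi | move: sr]; rewrite -eq /= => /andP[].
by case: eq => _ eq; exists P2, P1; split=> //; case/andP: sk.
Qed.

(** Converse of the previous lemma: a Skeleton root can always be prefixed to P2. *)
Lemma inductive_skeleton s t : skeleton L s t ->
  (forall o u, child t o u -> inductive (child_sign o s) u) -> inductive s t.
Proof.
move=> sk ind ns s' p br cr; case: (branch_childP br) => [[q tq _]|].
  by rewrite tq in sk.
case=> c [o [u [ns' [cu -> br']]]].
have [P2 [P1 [-> sk2 pi sr]]] := ind _ _ (ex_intro _ c cu) _ _ _ br' cr.
by exists ((s, t, c) :: P2), P1; split=> //=; rewrite sk.
Qed.

(** Conjunction and disjunction are Skeleton nodes under both signs, so their equivalences hold for
    every s; those of the other connectives are restricted to the sign that makes them Skeleton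
    nodes. *)
Lemma inductive_and s a b : inductive s (And a b) <-> inductive s a /\ inductive s b.
Proof.
split=> [ind|[inda indb]].
  split; first by apply: (inductive_child (o := true) ind); exists 0.
  by apply: (inductive_child (o := true) ind); exists 1.
by apply: inductive_skeleton => // o u /childP /= -[] [-> ->].
Qed.

Lemma inductive_or s a b : inductive s (Or a b) <-> inductive s a /\ inductive s b.
Proof.
split=> [ind|[inda indb]].
  split; first by apply: (inductive_child (o := true) ind); exists 0.
  by apply: (inductive_child (o := true) ind); exists 1.
by apply: inductive_skeleton => // o u /childP /= -[] [-> ->].
Qed.

Lemma inductive_imp a b : is_har L ->
  inductive false (Imp a b) <-> inductive true a /\ inductive false b.
Proof.
move=> har; split=> [ind|[inda indb]].
  split; first by apply: (inductive_child (o := false) ind); exists 0.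
  by apply: (inductive_child (o := true) ind); exists 1.
by apply: inductive_skeleton => [|o u /childP /= -[] [-> ->]] //=; rewrite har.
Qed.

Lemma inductive_f a :
  inductive true (Op_f a) <-> inductive (child_sign (eta_f sg) true) a.
Proof.
split=> [ind|ind]; first by apply: (inductive_child ind); exists 0.
by apply: inductive_skeleton => // o u /childP /= -[-> ->].
Qed.

Lemma inductive_g a :
  inductive false (Op_g a) <-> inductive (child_sign (eta_g sg) false) a.
Proof.
split=> [ind|ind]; first by apply: (inductive_child ind); exists 0.
by apply: inductive_skeleton => // o u /childP /= -[-> ->].
Qed.

Lemma inductive_k (ts : 'I_(arity_k sg) -> term sg) : inductive true (Op_k ts) <->
  forall i, inductive (child_sign (eps_k i) true) (ts i).
Proof.
split=> [ind i|ind]; first by apply: (inductive_child ind); apply: child_k.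
by apply: inductive_skeleton => // o u /child_kP[i [-> ->]].
Qed.

Lemma inductive_l (ts : 'I_(arity_l sg) -> term sg) : inductive false (Op_l ts) <->
  forall i, inductive (child_sign (eps_l i) false) (ts i).
Proof.
split=> [ind i|ind]; first by apply: (inductive_child ind); apply: child_l.
by apply: inductive_skeleton => // o u /child_lP[i [-> ->]].
Qed.

Lemma inductive_k_update (ts : 'I_(arity_k sg) -> term sg) i u :
  inductive true (Op_k ts) -> inductive (child_sign (eps_k i) true) u ->
  inductive true (Op_k (update ts i u)).
Proof.
by rewrite !inductive_k => ind indu j; rewrite /update; case: eqP => [->|_].
Qed.

Lemma inductive_l_update (ts : 'I_(arity_l sg) -> term sg) i u :
  inductive false (Op_l ts) -> inductive (child_sign (eps_l i) false) u ->
  inductive false (Op_l (update ts i u)).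
Proof.
by rewrite !inductive_l => ind indu j; rewrite /update; case: eqP => [->|_].
Qed.

(** Distribution only rearranges Skeleton nodes, so both trees are inductive exactly when the same
    subtrees are. *)
Lemma inductive_distr_root s t t' :
  distr_root L s t t' -> inductive s t -> inductive s t'.
Proof.
case=> [a b c|a b c|a b c|a b c|a b e|a b e|a b e|a b e
  |ts i a b e ti|ts i a b e ti|ts i a b e ti|ts i a b e ti|a b c h|a b c h].
1-4: by rewrite !(inductive_and, inductive_or); tauto.
1-4: by rewrite !(inductive_and, inductive_or, inductive_f, inductive_g).
1-4: move=> ind; have := ind; rewrite ?inductive_k ?inductive_l => /(_ i);
  rewrite ti ?e ?(negPf e) /= !(inductive_and, inductive_or) => -[inda indb];
  by split; (apply: inductive_k_update || apply: inductive_l_update);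
    rewrite ?e ?(negPf e).
all: by rewrite !(inductive_and, inductive_or, inductive_imp) //; tauto.
Qed.

Lemma inductive_distr s t t' : distr L s t t' -> inductive s t -> inductive s t'.
Proof.
elim=> {s t t'} [s t t'|s a a' b|s a b b'|s a a' b|s a b b'|s a a'|s a a'
  |s ts i u|s ts i u|s a a' b|s a b b']; first exact: inductive_distr_root.
1-4: by rewrite !(inductive_and, inductive_or); tauto.
1,2: by case: s => // _ _ IH; rewrite !(inductive_f, inductive_g).
1,2: case: s => // _ _ IH ind;
  (apply: inductive_k_update || apply: inductive_l_update) => //;
  by apply: IH; move: ind; rewrite ?inductive_k ?inductive_l; apply.
all: by case: s => /=; rewrite ?andbF ?andbT // => har _ IH;
  rewrite !inductive_imp //; tauto.
Qed.

(** * Inductivity under variable elimination *)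

Lemma skeleton_subst s p u t : constant u ->
  skeleton L s (subst p u t) = skeleton L s t.
Proof. by move=> cu; case: t => //= q; case: ifP => //; case: cu => ->. Qed.

Lemma pia_subst s p u t : constant u -> pia L s (subst p u t) = pia L s t.
Proof. by move=> cu; case: t => //= q; case: ifP => //; case: cu => ->. Qed.

Lemma srr_subst s p u t : constant u -> srr L s (subst p u t) = srr L s t.
Proof. by move=> cu; case: t => //= q; case: ifP => //; case: cu => ->. Qed.

Lemma side_subtree_subst q s p u t : constant u ->
  side_subtree Om eps q s t -> side_subtree Om eps q s (subst p u t).
Proof.
move=> cu /andP[ag /allP om]; have l0 := leaves_constant cu; apply/andP; split.
  rewrite /agrees leaves_subst_closed //; apply/allP => l.
  by rewrite mem_filter => /andP[_ /(allP ag)].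
apply/allP => r; rewrite (vars_leaves s) leaves_subst_closed //.
case/mapP => l; rewrite mem_filter => /andP[_ lt] ->.
by apply: om; rewrite (vars_leaves s); apply: map_f.
Qed.

Definition node_subst p u (nd : node sg) : node sg :=
  (nd.1.1, subst p u nd.1.2, nd.2).

Lemma srr_condition_subst q p u nd : constant u ->
  srr_condition Om eps q nd -> srr_condition Om eps q (node_subst p u nd).
Proof.
move=> cu; case: nd => [[s t] c].
by case: t => // a b; case: c => [|[|c]] //=; apply: side_subtree_subst.
Qed.

(** A constant carries no branch, so substituting it creates none: each branch comes from one of t
    with the same coordinates. *)
Lemma branch_subst s p u t ns s' q : constant u ->
  branch s (subst p u t) ns s' q ->
  exists2 ns0, branch s t ns0 s' q & ns = map (node_subst p u) ns0.
Proof.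
move=> cu; elim/term_child_ind: t s ns => t IH s ns br.
have nb s1 ns1 : ~ branch s1 u ns1 s' q.
  by case: cu => -> /branch_childP[[]//|[c [o [v [ns' [/=]]]]]]; rewrite onth0n.
have step : children (subst p u t) = [seq (x.1, subst p u x.2) | x <- children t] ->
    (forall r, subst p u t <> Var r) ->
    exists2 ns0, branch s t ns0 s' q & ns = map (node_subst p u) ns0.
  move=> ch nv; case: (branch_childP br) => [[r /nv]//|[c [o [v [ns' []]]]]].
  rewrite ch onth_map; case cw : (onth (children t) c) => [[o' w]|] //= -[<- <-] -> br'.
  have [ns0 br0 ->] := IH _ _ (ex_intro _ c cw) _ _ br'.
  by exists ((s, t, c) :: ns0) => //; apply: branch_node cw br0.
case: t {IH} br step => [r|x|x|||a b|a b|a|a|ts|ts|a b|a b|a|a] br step;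
  first (move: br => {step} /=; case: ifP => [_ /nb // | _ br]).
  case: (branch_childP br) => [[r' _ ns0]|[c [o [v [ns' [/=]]]]]].
    by exists [::]; rewrite ?ns0 //; move: br; rewrite ns0.
  by rewrite onth0n.
all: by apply: step => //=; rewrite -map_comp.
Qed.

Lemma inductive_subst s p u t : constant u ->
  inductive s t -> inductive s (subst p u t).
Proof.
move=> cu ind ns s' q /(branch_subst cu)[ns0 br ->] cr.
have [P2 [P1 [-> sk pi sr]]] := ind _ _ _ br cr.
exists (map (node_subst p u) P2), (map (node_subst p u) P1).
split; rewrite ?map_cat ?all_map //.
- by apply: sub_all sk => nd /=; rewrite skeleton_subst.
- by apply: sub_all pi => nd /=; rewrite pia_subst.
- apply: sub_all sr => nd /=; rewrite srr_subst // => /implyP h.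
  by apply/implyP => /h; apply: srr_condition_subst.
Qed.

Definition inductive_sides (e : ineq sg) : Prop :=
  inductive true e.1 /\ inductive false e.2.

Lemma inductive_prep_rule e ys : prep_rule L e ys -> inductive_sides e ->
  List.Forall inductive_sides ys.
Proof.
rewrite /inductive_sides.
case=> [a a' b d|a b b' d|a b c|a b c|p a b _ _ _|p a b _ _ _] /= [inda indb].
- by constructor=> //; split=> //; apply: inductive_distr inda.
- by constructor=> //; split=> //; apply: inductive_distr indb.
- by case/inductive_and: indb; do !constructor.
- by case/inductive_or: inda; do !constructor.
- by constructor=> //; split; apply: inductive_subst => //; right.
- by constructor=> //; split; apply: inductive_subst => //; left.
Qed.

Lemma inductive_preprocess E E' : clos_refl_trans _ (prep_step L) E E' ->
  List.Forall inductive_sides E -> List.Forall inductive_sides E'.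
Proof.
elim=> {E E'} [E E' []|//|E1 E2 E3 _ IH1 _ IH2 /IH1 /IH2 //].
move=> E1 x ys E2 xys /List.Forall_app[ind1 /List.Forall_cons_iff[indx ind2]].
do 2!(apply/List.Forall_app; split=> //); exact: inductive_prep_rule indx.
Qed.

(** * Distributed trees and PIA trees *)

Definition join_like s t : bool :=
  match t with Or _ _ => s | And _ _ => ~~ s | _ => false end.

(** The effect of exhaustive preprocessing on one side: splitting excludes a root +\/ or -/\, and no
    distribution is left inside. *)
Definition distributed s t : Prop :=
  ~~ join_like s t /\ forall t', ~ distr L s t t'.

(** A child +\/ or -/\ would let the root distribute over it, and a distribution inside the child is
    one inside t, since the root is a Skeleton node. *)
Lemma distributed_child s t o u : skeleton L s t -> distributed s t ->
  child t o u -> distributed (child_sign o s) u.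
Proof.
move=> sk [nj nd] cu.
have root t' : ~ distr_root L s t t' by move=> dt; apply: nd; apply: distr_here dt.
case: t sk nj nd root cu => // [a b|a b|a|a|ts|ts|a b].
- case: s => // sk _ nd root /childP /= -[] [-> ->]; split=> [|u' du].
  + by case: a root {nd sk} => // x y root; case: (root (Or (And x b) (And y b))); constructor.
  + by apply: nd; apply: distr_in_and_l du.
  + by case: b root {nd sk} => // x y root; case: (root (Or (And a x) (And a y))); constructor.
  + by apply: nd; apply: distr_in_and_r du.
- case: s => // sk _ nd root /childP /= -[] [-> ->]; split=> [|u' du].
  + by case: a root {nd sk} => // x y root; case: (root (And (Or x b) (Or y b))); constructor.
  + by apply: nd; apply: distr_in_or_l du.
  + by case: b root {nd sk} => // x y root; case: (root (And (Or a x) (Or a y))); constructor.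
  + by apply: nd; apply: distr_in_or_r du.
- case: s => // sk _ nd root /childP /= [-> ->]; split=> [|u' du].
  + case: a root {nd sk} => // x y root; apply/negP => /= e;
    case: (root (Or (Op_f x) (Op_f y))); constructor; by case: eta_f e.
  + by apply: nd; apply: distr_in_f du.
- case: s => // sk _ nd root /childP /= [-> ->]; split=> [|u' du].
  + case: a root {nd sk} => // x y root; apply/negP => /= e;
    case: (root (And (Op_g x) (Op_g y))); constructor; by case: eta_g e.
  + by apply: nd; apply: distr_in_g du.
- case: s => // sk _ nd root /child_kP[i [-> ->]]; split=> [|u' du].
  + case ti : (ts i) => [| | | | |x y|x y| | | | | | | |] //; apply/negP => /= e;
    case: (root (Or (Op_k (update ts i x)) (Op_k (update ts i y))));
    [apply: distr_k_ant ti | apply: distr_k_mon ti]; by case: eps_k e.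
  + by apply: nd; apply: distr_in_k du.
- case: s => // sk _ nd root /child_lP[i [-> ->]]; split=> [|u' du].
  + case ti : (ts i) => [| | | | |x y|x y| | | | | | | |] //; apply/negP => /= e;
    case: (root (And (Op_l (update ts i x)) (Op_l (update ts i y))));
    [apply: distr_l_mon ti | apply: distr_l_ant ti]; by case: eps_l e.
  + by apply: nd; apply: distr_in_l du.
- case: s => /= [|/andP[har _] _ nd root /childP /= -[] [-> ->]]; first by rewrite andbF.
  + split=> [|u' du].
      by case: a root {nd} => // x y root; case: (root (And (Imp x b) (Imp y b))); constructor.
    by apply: nd; apply: distr_in_imp_l du; rewrite /= har.
  + split=> [|u' du].
      by case: b root {nd} => // x y root; case: (root (And (Imp a x) (Imp a y))); constructor.
    by apply: nd; apply: distr_in_imp_r du; rewrite /= har.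
Qed.

(* What [inductive_tree] amounts to once the Skeleton part P2 of every critical
   branch is empty. *)
Definition pia_tree s t : Prop :=
  forall ns s' p, branch s t ns s' p -> critical eps s' p ->
  all (fun nd : node sg => pia L nd.1.1 nd.1.2 &&
         (srr L nd.1.1 nd.1.2 ==> srr_condition Om eps p nd)) ns.

(** A nonempty P2 would start at the root, which is not a Skeleton node. *)
Lemma inductive_pia s t : ~~ skeleton L s t -> inductive s t -> pia_tree s t.
Proof.
move=> nsk ind ns s' p br cr.
have [[|nd P2] [P1 [eq sk pi sr]]] := ind _ _ _ br cr.
  by rewrite all_predI eq; apply/andP.
case: (branch_childP br) => [[q _]|[c [o [u [ns' [_ nse _]]]]]]; first by rewrite eq.
by move: sk nsk; rewrite nse in eq; case: eq => <- _ /= /andP[->].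
Qed.

Lemma pia_child s t o u :
  pia_tree s t -> child t o u -> pia_tree (child_sign o s) u.
Proof.
by move=> pi [c cu] ns s' p br cr; have /andP[] := pi _ _ _ (branch_node cu br) cr.
Qed.

Lemma pia_node s t c o u l : pia_tree s t -> onth (children t) c = Some (o, u) ->
  l \in leaves (child_sign o s) u -> critical eps l.1 l.2 ->
  pia L s t && (srr L s t ==> srr_condition Om eps l.2 (s, t, c)).
Proof.
move=> pi cu /leaves_branch[ns br] cr.
by have /andP[] := pi _ _ _ (branch_node cu br) cr.
Qed.

End InductiveTrees.

(** * Reduction and elimination *)

Section Reduction.

Variables (sg : signature) (L : logic) (Om : rel nat) (eps : nat -> bool).
Hypothesis Om_irr : irreflexive Om.
Hypothesis Om_trans : transitive Om.
Implicit Types (a b r t u : term sg) (p q x : nat) (s : bool).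
Implicit Types (d : constr sg) (S B : system sg) (G : seq (system sg)).

(** * Composition of safe runs *)

Definition safely_solvable G : Prop := exists As G',
  [/\ run L G As G', all (all (fun d => ~~ side d)) As &
      all (all (fun d => pure (lhs d) && pure (rhs d))) G'].

(** A rule looks at a single system, its freshness conditions included, so other systems can be
    carried along. *)
Lemma run_catl G As G' H : run L G As G' -> run L (H ++ G) As (H ++ G').
Proof.
elim=> {G As G'} [G|G1 S G2 A Ss As G' red _ IH]; first by constructor.
by rewrite catA; apply: run_cons red _; rewrite -catA.
Qed.

Lemma run_catr G As G' H : run L G As G' -> run L (G ++ H) As (G' ++ H).
Proof.
elim=> {G As G'} [G|G1 S G2 A Ss As G' red _ IH]; first by constructor.
by rewrite -catA /=; apply: run_cons red _; rewrite -!catA in IH.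
Qed.

Lemma run_trans G1 G2 G3 As Bs :
  run L G1 As G2 -> run L G2 Bs G3 -> run L G1 (As ++ Bs) G3.
Proof. by elim=> {G1 As G2} //= G1 S G2 A Ss As G' red _ IH /IH; apply: run_cons. Qed.

Lemma solvable_nil : safely_solvable [::].
Proof. by exists [::], [::]; split=> //; constructor. Qed.

Lemma solvable_cat G H :
  safely_solvable G -> safely_solvable H -> safely_solvable (G ++ H).
Proof.
move=> [As [G' [runG sA pG]]] [Bs [H' [runH sB pH]]].
exists (As ++ Bs), (G' ++ H'); rewrite !all_cat sA sB pG pH; split=> //.
by apply: run_trans (run_catr H runG) _; apply: run_catl.
Qed.

Lemma solvable_reduce S A Ss : reduce L S A Ss -> all (fun d => ~~ side d) A ->
  safely_solvable Ss -> safely_solvable [:: S].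
Proof.
move=> red sA [As [G' [runSs sAs pG]]].
exists (A :: As), G'; split=> //=; last by rewrite sA.
by apply: (@run_cons _ _ [::] S [::] A Ss); rewrite //= cats0.
Qed.

Lemma solvable_rule S1 d S2 alts :
  rule L (S1 ++ d :: S2) (lhs d) (rhs d) alts -> ~~ side d ->
  safely_solvable [seq S1 ++ B ++ S2 | B <- alts] ->
  safely_solvable [:: S1 ++ d :: S2].
Proof.
by move=> /reduce_rule red nd; apply: solvable_reduce red _; rewrite /= nd.
Qed.

(** A whole final segment is provided because approximation of k and l needs as many fresh names as
    there are coordinates. *)
Lemma exists_fresh S : exists n, forall x, n <= x -> fresh S x.
Proof.
(* The segment starts at 1 for the empty system, since the name 0 is reserved. *)
elim: S => [|d S [n IH]]; first by exists 1 => x; case: x.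
exists (maxn n (foldr maxn 0 (names (lhs d) ++ names (rhs d))).+1) => x.
rewrite geq_max => /andP[/IH /andP[x0 frS] lt]; rewrite /fresh x0 /= frS andbT.
elim: (_ ++ _) lt => //= y ys IHy; rewrite gtn_max inE => /andP[yx /IHy].
by rewrite negb_or => ->; rewrite andbT neq_ltn yx orbT.
Qed.

(** * Inequalities that need no further reduction *)

(** A usable minimal valuation: r <= p for s = +, and p <= r for s = -. With Omega irreflexive, the
    last clause keeps p out of r. *)
Definition bounds s t r : bool :=
  if t is Var p then [&& s == eps p, agrees eps s r & all (Om^~ p) (vars r)]
  else false.

(* The inequalities that need no further reduction: those which only receive
   Ackermann substitutions, and the minimal valuations alpha <= p and
   p <= alpha. *)
Definition ready d : bool :=
  agrees eps true (lhs d) && agrees eps false (rhs d) ||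
  ~~ side d && (bounds true (rhs d) (lhs d) || bounds false (lhs d) (rhs d)).

(** The term t under reduction stands on the right when its sign is + and on the left when it is -;
    r is the side facing it. *)
Definition orient s t r : constr sg := if s then plain r t else plain t r.

(** [ready] reads the left side with sign + and the right side with sign -, so t is read with the
    sign opposite to s; there, agreement with the dual order type becomes agreement with [eps]. *)
Lemma ready_orient s t r :
  agrees (dual eps) s t -> agrees eps s r -> ready (orient s t r).
Proof.
move=> ht; have := agreesN eps (~~ s) t; rewrite negbK ht => /esym.
by case: s {ht} => ht hr; rewrite /ready /= hr ht.
Qed.

Lemma critical_leaf s t : ~~ agrees (dual eps) s t ->
  exists2 l, l \in leaves s t & critical eps l.1 l.2.
Proof.
by move=> /allPn[l lt]; rewrite /critical /dual => nl; exists l => //;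
  case: l.1 nl; case: (eps l.2).
Qed.

Lemma pia_root s t : pia_tree L Om eps s t -> ~~ agrees (dual eps) s t ->
  (if t is Var _ then true else pia L s t).
Proof.
move=> hpi /critical_leaf[l /leaves_branch[ns br] cr].
case: (branch_childP br) => [[q -> //]|[c [o [u [ns' [_ nse _]]]]]].
by have := hpi _ _ _ br cr; rewrite nse /= => /andP[/andP[-> _] _]; case: (t).
Qed.

(** b is the coordinate off the branch at an SRR root and s' its sign. One critical leaf l gives the
    order-type half of the condition; the Omega half is collected over all critical leaves. *)
Lemma pia_side s t c o u s' b l : pia_tree L Om eps s t -> srr L s t ->
  onth (children t) c = Some (o, u) ->
  (forall q, srr_condition Om eps q (s, t, c) = side_subtree Om eps q s' b) ->
  l \in leaves (child_sign o s) u -> critical eps l.1 l.2 ->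
  agrees (dual eps) s' b /\
  forall q, (eps q, q) \in leaves (child_sign o s) u -> all (Om^~ q) (vars b).
Proof.
move=> hpi sr cu cond lu cr.
have side q s2 : (s2, q) \in leaves (child_sign o s) u -> critical eps s2 q ->
    side_subtree Om eps q s' b.
  move=> qu crq; have := pia_node hpi cu qu crq.
  by rewrite sr cond => /andP[].
split=> [|q qu]; first by case: l lu cr => s2 q lu cr; case/andP: (side _ _ lu cr).
by case/andP: (side _ _ qu (eqxx _)).
Qed.

(** * Reduction of PIA trees *)

(* Continuation-passing form: whatever surrounds d in the system, d can be
   turned into ready inequalities. *)
Definition reducible d : Prop := forall S1 S2,
  (forall B, all ready B -> safely_solvable [:: S1 ++ B ++ S2]) ->
  safely_solvable [:: S1 ++ d :: S2].

Lemma ready_reducible d : ready d -> reducible d.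
Proof. by move=> rd S1 S2 K; apply: (K [:: d]); rewrite /= rd. Qed.

(** The members of B are reduced from the left; those already finished join the left context S1. *)
Lemma solvable_reducible S1 B S2 : List.Forall reducible B ->
  (forall B', all ready B' -> safely_solvable [:: S1 ++ B' ++ S2]) ->
  safely_solvable [:: S1 ++ B ++ S2].
Proof.
move=> rB; elim: rB S1 => {B} [|d B rd _ IH] S1 K; first exact: (K [::]).
apply: (rd S1 (B ++ S2)) => B1 rB1; rewrite catA; apply: IH => B2 rB2.
by rewrite -catA [B1 ++ _]catA; apply: K; rewrite all_cat rB1.
Qed.

(** The alternatives may depend on S because fresh names must avoid the whole surrounding system. *)
Lemma rule_reducible d :
  (forall S, exists2 alts, rule L S (lhs d) (rhs d) alts &
     List.Forall (List.Forall reducible) alts) ->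
  ~~ side d -> reducible d.
Proof.
move=> h nd S1 S2 K; have [As ru red] := h (S1 ++ d :: S2).
apply: solvable_rule ru nd _.
elim: red => [|B Bs rB _ IH]; first exact: solvable_nil.
by apply: (@solvable_cat [:: _] _ _ IH); apply: solvable_reducible.
Qed.

Lemma rule1_reducible d B : (forall S, rule L S (lhs d) (rhs d) [:: B]) ->
  ~~ side d -> List.Forall reducible B -> reducible d.
Proof. by move=> h nd rB; apply: rule_reducible => // S; exists [:: B]; do ?constructor. Qed.

(** Induction down the critical branches, with r general. Splitting and adjunction pass SMP nodes;
    residuation passes SRR nodes and moves the side subtree into r, where the SRR condition restores
    both hypotheses on r. At a critical leaf these hypotheses make r a minimal valuation. *)
Lemma reducible_pia s t r :
  pia_tree L Om eps s t -> agrees eps s r ->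
  (forall q, (eps q, q) \in leaves s t -> all (Om^~ q) (vars r)) ->
  reducible (orient s t r).
Proof.
elim/term_child_ind: t s r => t IH s r hpi agr om.
(* Without critical leaves there is nothing to solve for; otherwise a critical leaf l shows which
   coordinate to follow. *)
case: (boolP (agrees (dual eps) s t)) => [agt|nag].
  by apply: ready_reducible; apply: ready_orient.
have pit := pia_root hpi nag; have [l lt cr] := critical_leaf nag.
have omc c o u q : onth (children t) c = Some (o, u) ->
    (eps q, q) \in leaves (child_sign o s) u -> all (Om^~ q) (vars r).
  by move=> cu qu; apply: om; apply: leaves_child qu; exists c.
have rec c o u r' : onth (children t) c = Some (o, u) ->
    agrees eps (child_sign o s) r' ->
    (forall q, (eps q, q) \in leaves (child_sign o s) u -> all (Om^~ q) (vars r')) ->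
    reducible (orient (child_sign o s) u r').
  by move=> cu ag omr; apply: (IH o u) => //; [|apply: pia_child hpi _]; exists c.
(* The SRR case: r' is built from r and the side subtree b, so its variables lie below each critical
   leaf of u. *)
have rec_side c o u s' b r' : srr L s t -> onth (children t) c = Some (o, u) ->
    (forall q, srr_condition Om eps q (s, t, c) = side_subtree Om eps q s' b) ->
    l \in leaves (child_sign o s) u ->
    (agrees (dual eps) s' b -> agrees eps (child_sign o s) r') ->
    vars r' =i vars b ++ vars r ->
    reducible (orient (child_sign o s) u r').
  move=> sr cu cond lu ag vr; have [ags oms] := pia_side hpi sr cu cond lu cr.
  apply: (rec c) => //; first exact: ag.
  by move=> q qu; rewrite (eq_all_r vr) all_cat (oms _ qu) (omc _ _ _ _ cu qu).
have vcat s1 s2 a b : unzip2 (leaves s1 a ++ leaves s2 b) =i vars a ++ vars b.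
  by move=> q; rewrite vars_cat.
case: t {IH} hpi om nag pit lt omc rec rec_side => [p|x|x|||a b|a b|a|a|ts|ts
    |a b|a b|a|a] // hpi om nag pit lt omc rec rec_side.
- move: lt cr; rewrite inE => /eqP -> /= /eqP sp.
  have omp : all (Om^~ p) (vars r) by apply: om; rewrite sp inE eqxx.
  apply: ready_reducible; case: s sp agr {hpi om nag omc rec rec_side} => sp agr;
  by rewrite /ready /= -?sp eqxx agr omp ?orbT.
- case: s agr hpi om nag pit lt omc rec rec_side => agr _ _ _ _ lt omc rec rec_side.
    apply: (rule1_reducible (B := [:: orient true a r; orient true b r])) => //.
      by move=> S; constructor.
    constructor; first by apply: (rec 0 true) => // q; apply: (omc 0 true).
    by constructor=> //; apply: (rec 1 true) => // q; apply: (omc 1 true).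
  (* If one conjunct contains l, the other agrees with the dual order type, has no critical leaf and
     can be moved across. *)
  move: lt; rewrite mem_cat => /orP[la|lb].
    apply: (rule1_reducible (B := [:: orient false a (Imp b r)])) => //.
      by move=> S; apply: resid_and_r.
    constructor=> //; apply: (rec_side 0 true a false b) => //= [ags|];
      last exact: vcat.
    by rewrite /agrees /= all_cat -/(agrees eps true b) -agreesN ags.
  apply: (rule1_reducible (B := [:: orient false b (Imp a r)])) => //.
    by move=> S; apply: resid_and_l.
  constructor=> //; apply: (rec_side 1 true b false a) => //= [ags|];
    last exact: vcat.
  by rewrite /agrees /= all_cat -/(agrees eps true a) -agreesN ags.
- case: s agr hpi om nag pit lt omc rec rec_side => agr _ _ _ _ lt omc rec rec_side;
    last first.
    apply: (rule1_reducible (B := [:: orient false a r; orient false b r])) => //.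
      by move=> S; constructor.
    constructor; first by apply: (rec 0 true) => // q; apply: (omc 0 true).
    by constructor=> //; apply: (rec 1 true) => // q; apply: (omc 1 true).
  have swap u : unzip2 (leaves true r ++ leaves false u) =i vars u ++ vars r.
    by move=> q; rewrite vars_cat !mem_cat orbC.
  move: lt; rewrite mem_cat => /orP[la|lb].
    apply: (rule1_reducible (B := [:: orient true a (Diff r b)])) => //.
      by move=> S; apply: resid_or_l.
    constructor=> //; apply: (rec_side 0 true a true b) => //= [ags|];
      last exact: swap.
    by rewrite /agrees /= all_cat -/(agrees eps false b) -agreesN ags andbT.
  apply: (rule1_reducible (B := [:: orient true b (Diff r a)])) => //.
    by move=> S; apply: resid_or_r.
  constructor=> //; apply: (rec_side 1 true b true a) => //= [ags|];
    last exact: swap.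
  by rewrite /agrees /= all_cat -/(agrees eps false a) -agreesN ags andbT.
- case: s agr pit omc rec {hpi om nag lt rec_side} => // agr _ omc rec.
  have vadj : vars (Adj_f r) = vars r by rewrite [RHS](vars_leaves (child_sign (eta_f sg) true)).
  (* The adjoint has the order type of [Op_f], so the two sign changes cancel and r keeps its
     sign. *)
  have ragr : agrees eps (child_sign (eta_f sg) false) (Adj_f r).
    by move: agr; rewrite /agrees /=; case: (eta_f sg).
  (* The side condition agrees with [eps] on both sides, since [Op_f c] has no leaves; it is ready
     without being a minimal valuation. *)
  have readyc c : constant c -> ready (side_condition (Op_f c) r).
    by case=> ->; rewrite /ready /= agr.
  have := rec 0 (eta_f sg) a (Adj_f r) erefl ragr; rewrite vadj.
  move=> /(_ (fun q => omc 0 _ _ q erefl)).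
  case e : (eta_f sg) => red.
    apply: (rule1_reducible (B := [:: side_condition (Op_f Bot) r; _])) => //.
      by move=> S; apply: adj_f_mon.
    by do !constructor=> //; apply: ready_reducible; apply: readyc; right.
  apply: (rule1_reducible (B := [:: side_condition (Op_f Top) r; _])) => //.
    by move=> S; apply: adj_f_ant; rewrite e.
  by do !constructor=> //; apply: ready_reducible; apply: readyc; left.
- case: s agr pit omc rec {hpi om nag lt rec_side} => // agr _ omc rec.
  have vadj : vars (Adj_g r) = vars r by rewrite [RHS](vars_leaves (child_sign (eta_g sg) true)).
  have ragr : agrees eps (child_sign (eta_g sg) true) (Adj_g r).
    by move: agr; rewrite /agrees /=; case: (eta_g sg).
  have readyc c : constant c -> ready (side_condition r (Op_g c)).
    by case=> ->; rewrite /ready /= agr.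
  have := rec 0 (eta_g sg) a (Adj_g r) erefl ragr; rewrite vadj.
  move=> /(_ (fun q => omc 0 _ _ q erefl)).
  case e : (eta_g sg) => red.
    apply: (rule1_reducible (B := [:: side_condition r (Op_g Top); _])) => //.
      by move=> S; apply: adj_g_mon.
    by do !constructor=> //; apply: ready_reducible; apply: readyc; left.
  apply: (rule1_reducible (B := [:: side_condition r (Op_g Bot); _])) => //.
    by move=> S; apply: adj_g_ant; rewrite e.
  by do !constructor=> //; apply: ready_reducible; apply: readyc; right.
- case/andP: pit => har; case: s agr hpi om nag lt omc rec rec_side =>
    // agr hpi _ _ lt omc rec rec_side _.
  have srI : srr L true (Imp a b) by rewrite /= har.
  move: lt; rewrite mem_cat => /orP[la|lb].
    (* [srr_condition] rejects coordinate 0 of an implication, so l cannot lie in the antecedent. *)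
    have := @pia_node _ _ _ _ _ _ 0 false a l hpi erefl la cr.
    by rewrite srI andbF.
  apply: (rule1_reducible (B := [:: orient true b (And a r)])) => //.
    by move=> S; apply: resid_imp.
  constructor=> //; apply: (rec_side 1 true b false a) => //= [ags|];
    last exact: vcat.
  by rewrite /agrees /= all_cat -/(agrees eps true a) -agreesN ags.
Qed.

(** * Approximation of the Skeleton part *)

Definition name s x : term sg := if s then Nom x else Conom x.

Lemma leaves_name s s' x : leaves s (name s' x) = [::].
Proof. by case: s'. Qed.

Lemma forall_map (T U : Type) (P : U -> Prop) (f : T -> U) xs :
  (forall y, P (f y)) -> List.Forall P (map f xs).
Proof. by move=> h; elim: xs => [|y xs IH] /=; constructor. Qed.

(** Splitting handles +/\ and -\/, approximation the remaining Skeleton nodes; [distributed]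
    excludes +\/ and -/\. At the first node that is not Skeleton the PIA reduction takes over, its
    hypotheses on r being trivial for a name. *)
Lemma reducibleductive s t x : inductive_tree L Om eps s t ->
  distributed L s t -> reducible (orient s t (name s x)).
Proof.
elim/term_child_ind: t s x => t IH s x ind dis.
case: (boolP (skeleton L s t)) => [sk|nsk]; last first.
  apply: reducible_pia; [exact: inductive_pia| | move=> q _];
  by rewrite ?/agrees ?/vars leaves_name.
have rec c o u y : onth (children t) c = Some (o, u) ->
    reducible (orient (child_sign o s) u (name (child_sign o s) y)).
  move=> cu; have chu : child t o u by exists c.
  by apply: (IH _ _ chu); [apply: (inductive_child ind chu)
                         | apply: (distributed_child sk dis chu)].
(* For the pure inequality that each approximation leaves behind. *)
have ready0 a b : leaves true a = [::] -> leaves false b = [::] ->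
    reducible (plain a b).
  by move=> a0 b0; apply: ready_reducible; rewrite /ready /agrees /= a0 b0.
case: t sk {IH ind} dis rec => // [a b|a b|a|a|ts|ts|a b] sk [nj _] rec.
- case: s {sk} nj rec => // _ rec.
  apply: (rule1_reducible (B := [:: orient true a (Nom x); orient true b (Nom x)])) => //.
    by move=> S; constructor.
  by do !constructor; [apply: (rec 0 true) | apply: (rec 1 true)].
- case: s {sk} nj rec => // _ rec.
  apply: (rule1_reducible
    (B := [:: orient false a (Conom x); orient false b (Conom x)])) => //.
    by move=> S; constructor.
  by do !constructor; [apply: (rec 0 true) | apply: (rec 1 true)].
- case: s sk {nj} rec => // _ rec; apply: rule_reducible => // S.
  have [n frn] := exists_fresh S; have := rec 0 (eta_f sg) a n erefl.
  case e : (eta_f sg) => red.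
    exists [:: [:: plain (Nom x) (Op_f Bot)];
        [:: plain (Nom n) a; plain (Nom x) (Op_f (Nom n))]].
      by apply: approx_f_mon => //; apply: frn.
    by do !constructor=> //; apply: ready0.
  exists [:: [:: plain (Nom x) (Op_f Top)];
      [:: plain a (Conom n); plain (Nom x) (Op_f (Conom n))]].
    by apply: approx_f_ant; [rewrite e | apply: frn].
  by do !constructor=> //; apply: ready0.
- case: s sk {nj} rec => // _ rec; apply: rule_reducible => // S.
  have [n frn] := exists_fresh S; have := rec 0 (eta_g sg) a n erefl.
  case e : (eta_g sg) => red.
    exists [:: [:: plain (Op_g Top) (Conom x)];
        [:: plain a (Conom n); plain (Op_g (Conom n)) (Conom x)]].
      by apply: approx_g_mon => //; apply: frn.
    by do !constructor=> //; apply: ready0.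
  exists [:: [:: plain (Op_g Bot) (Conom x)];
      [:: plain (Nom n) a; plain (Op_g (Nom n)) (Conom x)]].
    by apply: approx_g_ant; [rewrite e | apply: frn].
  by do !constructor=> //; apply: ready0.
- case: s sk {nj} rec => // _ rec; apply: rule_reducible => // S.
  (* Shifting the coordinate by n gives pairwise distinct names in the fresh segment. *)
  have [n frn] := exists_fresh S; pose v (e : 'I_(arity_k sg)) := n + e.
  exists [seq approx_k x ts v Q | Q <- enum {set 'I_(arity_k sg)}].
    apply: approx_k_all => [e e' /addnI /ord_inj //|e].
    by apply: frn; apply: leq_addr.
  apply: forall_map => Q; constructor.
    apply: ready0 => //=; elim: (enum _) => //= e es ->; rewrite cats0.
    by case: ifP => _; case: (eps_k e).
  apply: forall_map => e; have [c ce] := child_k ts e.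
  by have := rec _ _ _ (v e) ce; case: (eps_k e).
- case: s sk {nj} rec => // _ rec; apply: rule_reducible => // S.
  have [n frn] := exists_fresh S; pose v (e : 'I_(arity_l sg)) := n + e.
  exists [seq approx_l x ts v Q | Q <- enum {set 'I_(arity_l sg)}].
    apply: approx_l_all => [e e' /addnI /ord_inj //|e].
    by apply: frn; apply: leq_addr.
  apply: forall_map => Q; constructor.
    apply: ready0 => //=; elim: (enum _) => //= e es ->; rewrite cats0.
    by case: ifP => _; case: (eps_l e).
  apply: forall_map => e; have [c ce] := child_l ts e.
  by have := rec _ _ _ (v e) ce; case: (eps_l e).
- case/andP: sk => har; case: s {nj} rec => // rec _.
  apply: rule_reducible => // S; have [n frn] := exists_fresh S.
  (* One index serves twice, as a nominal and as a conominal. *)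
  exists [:: [:: plain (Nom n) a; plain b (Conom n);
      plain (Imp (Nom n) (Conom n)) (Conom x)]].
    by apply: approx_imp => //; apply: frn.
  do !constructor; [exact: (rec 0 false) | exact: (rec 1 true) | exact: ready0].
Qed.

(** * Elimination of the variables by the Ackermann rules *)

Lemma agrees_bigjoin s (ts : seq (term sg)) : all (agrees eps s) ts -> agrees eps s (bigjoin ts).
Proof.
elim: ts => //= a [|b ts] IH /andP[aa abts] //.
by rewrite /agrees /= all_cat; apply/andP; split=> //; apply: IH.
Qed.

Lemma agrees_bigmeet s (ts : seq (term sg)) : all (agrees eps s) ts -> agrees eps s (bigmeet ts).
Proof.
elim: ts => //= a [|b ts] IH /andP[aa abts] //.
by rewrite /agrees /= all_cat; apply/andP; split=> //; apply: IH.
Qed.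

Lemma vars_bigjoin (P : pred nat) (ts : seq (term sg)) :
  all (fun t => all P (vars t)) ts -> all P (vars (bigjoin ts)).
Proof.
elim: ts => //= a [|b ts] IH /andP[aa abts] //.
by rewrite /vars /= vars_cat all_cat aa; apply: IH.
Qed.

Lemma vars_bigmeet (P : pred nat) (ts : seq (term sg)) :
  all (fun t => all P (vars t)) ts -> all P (vars (bigmeet ts)).
Proof.
elim: ts => //= a [|b ts] IH /andP[aa abts] //.
by rewrite /vars /= vars_cat all_cat aa; apply: IH.
Qed.

(** t is a variable q other than p. If p occurs in r, it is below q, and by transitivity so are the
    variables of u. *)
Lemma bounds_subst p u s t r : ~~ is_var p t -> agrees eps (eps p) u ->
  all (Om^~ p) (vars u) -> bounds s t r -> bounds s (subst p u t) (subst p u r).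
Proof.
case: t => //= q /negPf qp au omu /and3P[sq ar /allP omr].
rewrite qp /= sq agrees_subst //=; apply/allP => y /vars_subst[[yr _]|[yu pr]].
  exact: omr.
by apply: Om_trans (omr _ pr); apply: (allP omu).
Qed.

Lemma ready_subst p u d :
  ~~ is_var p (if eps p then rhs d else lhs d) ->
  agrees eps (eps p) u -> all (Om^~ p) (vars u) -> ready d ->
  ready (subst_constr p u d).
Proof.
move=> nv au omu /orP[/andP[al ar]|/andP[nd]].
  by rewrite /ready /= !agrees_subst.
(* On the side not covered by [nv], a bound has sign other than [eps p], whereas a bound on p must
   have sign [eps p]. *)
have nvt s t r : bounds s t r -> s != eps p -> ~~ is_var p t.
  by case: t => //= q /and3P[/eqP -> _ _]; apply: contra => /eqP ->.
rewrite /ready /= nd => /orP[b|b]; apply/orP; right; rewrite /=.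
  rewrite bounds_subst //; case e : (eps p) nv => //= _; apply: nvt b _.
  by rewrite e.
rewrite orbC bounds_subst //; case e : (eps p) nv => //= _; apply: nvt b _.
by rewrite e.
Qed.

(** The source of safety: p alone on the side selected by [eps p] disagrees with [eps] there, so d
    can only be a minimal valuation for p, and these are never side conditions. *)
Lemma ready_var s p d : ready d -> eps p = s ->
  is_var p (if s then rhs d else lhs d) ->
  [/\ ~~ side d, agrees eps s (if s then lhs d else rhs d) &
      all (Om^~ p) (vars (if s then lhs d else rhs d))].
Proof.
rewrite /ready; case: d => l r sd /= /[swap].
case: s => ep; [case: r | case: l] => //= q + /eqP qp; rewrite {}qp /agrees /=;
  rewrite /critical ep /= ?andbF ?andbT ?orbF.
- case/orP=> [//|/andP[-> /orP[/andP[-> -> //]|]]].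
  by case: l => //= q'; rewrite /agrees /= /critical ep /= andbF.
- case/andP=> -> /orP[|/andP[-> ->] //].
  by case: r => //= q'; rewrite /agrees /= /critical ep /= andbF.
Qed.

Definition vars_in (vs : seq nat) d : bool :=
  all (mem vs) (vars (lhs d)) && all (mem vs) (vars (rhs d)).

(** By irreflexivity p does not occur in u, so it disappears from the system. *)
Lemma vars_in_subst p vs u d : all (Om^~ p) (vars u) ->
  all (mem (p :: vs)) (vars u) -> vars_in (p :: vs) d ->
  vars_in vs (subst_constr p u d).
Proof.
move=> /allP omu /allP vu /andP[/allP vl /allP vr].
have vsu t : {subset vars t <= p :: vs} -> all (mem vs) (vars (subst p u t)).
  move=> vt; apply/allP => y /vars_subst[[/vt] | [yu _]].
    by rewrite inE => /orP[-> //|].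
  have : y \in p :: vs by apply: vu.
  by rewrite inE; case: eqP (omu _ yu) => // -> /=; rewrite Om_irr.
by rewrite /vars_in !vsu.
Qed.

(** Induction on a list covering the variables of S. Its order is irrelevant, since eliminating any
    p keeps the remaining inequalities ready. *)
Lemma solvable_ackermann vs S :
  all ready S -> all (vars_in vs) S -> safely_solvable [:: S].
Proof.
elim: vs S => [|p vs IH] S rS vS.
  exists [::], [:: S]; split=> //=; first by constructor.
  rewrite andbT; apply: sub_all vS => d /andP[].
  by rewrite /pure; case: (vars (lhs d)); case: (vars (rhs d)).
have {}rS : all (predI ready (vars_in (p :: vs))) S by rewrite all_predI rS.
(* The system left by either Ackermann rule, for any admissible substituted term u. *)
have after u : agrees eps (eps p) u -> all (Om^~ p) (vars u) ->
    all (mem (p :: vs)) (vars u) -> safely_solvable [::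
      [seq subst_constr p u d | d <- S & ~~ is_var p (if eps p then rhs d else lhs d)]].
  move=> au omu vu; apply: IH; rewrite all_map all_filter;
  apply: sub_all rS => d /andP[rd vd]; apply/implyP => nv /=.
    exact: ready_subst.
  exact: vars_in_subst.
have not_in t : all (Om^~ p) (vars t) -> p \notin vars t.
  by move/allP => om; apply/negP => /om; rewrite Om_irr.
case e : (eps p) after => after.
  pose A := [seq d <- S | is_var p (rhs d)].
  have hA : all (fun d => [&& ~~ side d, agrees eps true (lhs d),
      all (Om^~ p) (vars (lhs d)) & all (mem (p :: vs)) (vars (lhs d))]) A.
    rewrite all_filter; apply: sub_all rS => d /andP[rd /andP[vd _]].
    by apply/implyP => /(ready_var rd e)[-> -> ->].
  have red := @ackermann_right _ L p S; apply: solvable_reduce (red _ _) _ _.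
  - by apply: sub_all hA => d /and4P[_ _ /not_in].
  (* Polarity of the kept inequalities: agreement with [eps] gives it except at the variable of a
     bound; in alpha <= q that variable is not p, and in q <= alpha a bare variable is positive
     anyway. *)
  - rewrite all_filter; apply: sub_all rS => d /andP[rd _].
    apply/implyP => nv; case/orP: rd => [/andP[al ar]|/andP[_ /orP[]]].
    + by rewrite (positive_agrees al e) (negative_agrees ar e).
    + case: (rhs d) nv => //= q qp /and3P[_ al _].
      by rewrite (positive_agrees al e) /negative /= (negPf qp).
    + case: (lhs d) => //= q /and3P[_ ar _].
      by rewrite (negative_agrees ar e) /positive /= implybT.
  - by apply: sub_all hA => d /and4P[].
  - apply: after; [apply: agrees_bigjoin | apply: vars_bigjoin ..];
    by rewrite all_map; apply: sub_all hA => d /and4P[].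
pose A := [seq d <- S | is_var p (lhs d)].
have hA : all (fun d => [&& ~~ side d, agrees eps false (rhs d),
    all (Om^~ p) (vars (rhs d)) & all (mem (p :: vs)) (vars (rhs d))]) A.
  rewrite all_filter; apply: sub_all rS => d /andP[rd /andP[_ vd]].
  by apply/implyP => /(ready_var rd e)[-> -> ->].
have red := @ackermann_left _ L p S; apply: solvable_reduce (red _ _) _ _.
- by apply: sub_all hA => d /and4P[_ _ /not_in].
- rewrite all_filter; apply: sub_all rS => d /andP[rd _].
  move/negbT in e; apply/implyP => nv.
  case/orP: rd => [/andP[al ar]|/andP[_ /orP[]]].
  + by rewrite (negative_agreesN al e) (positive_agreesN ar e).
  + case: (rhs d) => //= q /and3P[_ al _].
    by rewrite (negative_agreesN al e) /positive /= implybT.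
  + case: (lhs d) nv => //= q qp /and3P[_ ar _].
    by rewrite (positive_agreesN ar e) /negative /= (negPf qp).
- by apply: sub_all hA => d /and4P[].
- apply: after; [apply: agrees_bigmeet | apply: vars_bigmeet ..];
  by rewrite all_map; apply: sub_all hA => d /and4P[].
Qed.

Lemma solvable_ready S : all ready S -> safely_solvable [:: S].
Proof.
move=> rS.
apply: (@solvable_ackermann (flatten [seq vars (lhs d) ++ vars (rhs d) | d <- S])) => //.
elim: S {rS} => //= d S IH; rewrite /vars_in; apply/andP; split.
  by apply/andP; split; apply/allP => y yd; rewrite inE !mem_cat yd ?orbT.
apply: sub_all IH => d' /andP[/allP vl /allP vr].
by apply/andP; split; apply/allP => y; [move/vl | move/vr];
  rewrite !inE => h; rewrite mem_cat h orbT.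
Qed.

(** * Initial systems and the complete execution *)

Lemma solvable_initial (e : ineq sg) : inductive_sides L Om eps e ->
  (forall ys, ~ prep_rule L e ys) -> safely_solvable [:: initial_system e].
Proof.
case: e => a b [/= inda indb] nopr.
(* A root +\/ on the left, or -/\ on the right, would still admit splitting, contrary to
   exhaustiveness. *)
have disa : distributed L true a.
  split=> [|a' da]; last by apply: (nopr [:: (a', b)]); constructor.
  by case: a nopr {inda} => // a1 a2 nopr; case: (nopr [:: (a1, b); (a2, b)]); constructor.
have disb : distributed L false b.
  split=> [|b' db]; last by apply: (nopr [:: (a, b')]); constructor.
  by case: b nopr {indb disa} => // b1 b2 nopr; case: (nopr [:: (a, b1); (a, b2)]); constructor.
have K := @solvable_reducible [::] (initial_system (a, b)) [::].
rewrite cats0 in K; apply: K.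
  by do !constructor; [apply: (@reducibleductive true) |
                       apply: (@reducibleductive false)].
by move=> B rB; rewrite cats0; apply: solvable_ready.
Qed.

End Reduction.

Lemma exhausted_prep_rule (sg : signature) (L : logic) (E : seq (ineq sg)) :
  (forall E', ~ prep_step L E E') ->
  List.Forall (fun e => forall ys, ~ prep_rule L e ys) E.
Proof.
move=> no; apply/List.Forall_forall => e /(@List.in_split _ _ _)[E1 [E2 eE]] ys eys.
by apply: (no (E1 ++ ys ++ E2)); rewrite eE; apply: PrepStep.
Qed.

Theorem theorem7p12 (sg : signature) (L : logic) (phi psi : term sg)
    (phi_lang : lang_term L phi) (psi_lang : lang_term L psi)
    (phi_psi_inductive : inductive_ineq L phi psi) :
  exists x : execution L phi psi, safe x /\ successful x.
Proof.
case: phi_psi_inductive => Om [eps [Om_irr Om_trans ind_phi ind_psi]].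
have [E [prepE nostep]] := exhaustive_preprocessing L [:: (phi, psi)].
have indE : List.Forall (inductive_sides L Om eps) E.
  by apply: inductive_preprocess prepE _; do !constructor.
have [As [G [runE sA pG]]] : safely_solvable L [seq initial_system e | e <- E].
  (* The initial systems are solved one after another and their runs concatenated. *)
  elim: indE (exhausted_prep_rule nostep) => [_|e E1 inde _ IH].
    exact: solvable_nil.
  case/List.Forall_cons_iff => noe /IH; apply: (@solvable_cat _ _ [:: _]).
  exact: solvable_initial Om_irr Om_trans _ inde noe.
by exists (Execution (conj prepE nostep) runE).
Qed.
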